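(* Let $d\ge 1$ be an integer, let $c\in\{1,2,\ldots,d\}$ and let $p>1$ be a real number. There exists a constant $C>0$, not depending on $w$ or $f$, such that the following holds. For every weight $w$ on $\mathbb{R}^d$, with $W=\mathfrak{M}_c\mathfrak{M}_{c-1}\cdots\mathfrak{M}_1 w$, and every locally integrable function $f$ on $\mathbb{R}^d$, $$ \|\mathfrak{M}_c f\|_{L^p(\mathbb{R}^d,w)}\le C\,\|f\|_{L^p(\mathbb{R}^d,W)}. $$
   Context: A weight on $\mathbb{R}^d$ is a non-negative, locally integrable function. For a non-negative measurable $v$ (possibly taking the value $+\infty$, with the convention $0\cdot\infty=0$), $\|f\|_{L^p(\mathbb{R}^d,v)}=\left(\int_{\mathbb{R}^d}|f|^pv\,dx\right)^{1/p}\in[0,\infty]$. $|E|$ is the Lebesgue measure of $E$. A rectangle in $\mathbb{R}^d$ means a product of $d$ bounded intervals of positive length (sides parallel to the coordinate axes). For $c\in\{1,\ldots,d\}$, $\mathcal{R}_c$ denotes the set of all such rectangles having complexity $c$: those for which there are $\alpha_1,\ldots,\alpha_c>0$ (varying with the rectangle) such that each of the $d$ sidelengths equals one of $\alpha_1,\ldots,\alpha_c$. Thus $\mathcal{R}_1$ is the set of axis-parallel cubes and $\mathcal{R}_d$ is the set of all axis-parallel rectangles. The maximal operator $\mathfrak{M}_c$ is defined by $$ \mathfrak{M}_c f(x)=\sup_{R\in\mathcal{R}_c}\mathbf{1}_R(x)\,\frac{1}{|R|}\int_R|f|\,dy , $$ with values in $[0,\infty]$, where $\mathbf{1}_R$ is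 the characteristic function of $R$. In compositions such as $\mathfrak{M}_c\mathfrak{M}_{c-1}\cdots\mathfrak{M}_1w$ (apply $\mathfrak{M}_1$ first, then $\mathfrak{M}_2$, and so on up to $\mathfrak{M}_c$), the same formula is applied to $[0,\infty]$-valued measurable functions. *)

(* Defs.v *)
From HB Require Import structures.
From mathcomp Require Import all_boot all_order all_algebra.
From mathcomp Require Import all_classical all_reals all_analysis.
Set Implicit Arguments.
Unset Strict Implicit.
Unset Printing Implicit Defensive.
Import Order.TTheory GRing.Theory Num.Theory.
Import numFieldNormedType.Exports.
Local Open Scope classical_set_scope.
Local Open Scope ring_scope.
Local Open Scope ereal_scope.

Section cons_measure.
Context (R : realType) (d : nat).
Local Notation T := (measurableTypeR R).
Variable mu : {measure set (d.-tuple T) -> \bar R}.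

Definition cons_pair (z : T * d.-tuple T) : d.+1.-tuple T :=
  [tuple of z.1 :: z.2].

Lemma measurable_cons_pair : measurable_fun [set: T * d.-tuple T] cons_pair.
Proof. exact: measurable_cons. Qed.

Definition cons_measure : set (d.+1.-tuple T) -> \bar R :=
  pushforward (@lebesgue_measure R \x^ mu) cons_pair.

Let cons_measure0 : cons_measure set0 = 0.
Proof. by apply: measure0; exact: measurable_cons_pair. Qed.

Let cons_measure_ge0 A : 0 <= cons_measure A.
Proof. by apply: measure_ge0; exact: measurable_cons_pair. Qed.

Let cons_measure_sigma_additive : semi_sigma_additive cons_measure.
Proof. by apply: measure_semi_sigma_additive; exact: measurable_cons_pair. Qed.

HB.instance Definition _ := isMeasure.Build _ _ _ cons_measure
  cons_measure0 cons_measure_ge0 cons_measure_sigma_additive.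

End cons_measure.

(* The d-fold product of one-dimensional Lebesgue measure, on the Borel sets *)
Fixpoint borel_lebesgue (R : realType) (d : nat) :
    {measure set (d.-tuple (measurableTypeR R)) -> \bar R} :=
  match d with
  | 0 => \d_([tuple] : 0.-tuple (measurableTypeR R))
  | d'.+1 => cons_measure (borel_lebesgue R d')
  end.

(* R^d with the sigma-algebra of all its Lebesgue measurable sets (the
   Caratheodory sigma-algebra of Lebesgue outer measure), not only the Borel
   ones; the measure [lebesgue] on it is complete. *)
Definition Rn (R : realType) (d : nat) : measurableType _ :=
  caratheodory_type (mu_ext (borel_lebesgue R d)).

Definition lebesgue (R : realType) (d : nat) :
    {measure set (Rn R d) -> \bar R} :=
  @completed_measure_extension _ _ R (borel_lebesgue R d).

Definition coordRn (R : realType) (d : nat) (x : Rn R d) (i : 'I_d) : R :=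
  tnth (x : d.-tuple R) i.

(* Tuples carry no topology in the library: compactness is that of 'rV[R]_d. *)
Definition locally_integrable_Rn (R : realType) (d : nat) (f : Rn R d -> R) :=
  measurable_fun setT f /\
  forall K : set 'rV[R]_d, compact K ->
    \int[@lebesgue R d]_(x in [set x | K (\row_i coordRn x i)]) `|f x|%:E < +oo.

Definition weight (R : realType) (d : nat) (w : Rn R d -> R) :=
  (forall x, 0 <= w x)%R /\ locally_integrable_Rn w.

Definition weighted_Lnorm (R : realType) (d : nat) (v : Rn R d -> \bar R)
    (p : R) (f : Rn R d -> \bar R) : \bar R :=
  (\int[@lebesgue R d]_x (`|f x| `^ p * v x)) `^ p^-1.

(* [l i] and [r i] record whether the left, resp. right, endpoint of the i-th interval belongs
   to it. *)
Definition rectangle (R : realType) (d : nat) (a b : 'I_d -> R)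
    (l r : 'I_d -> bool) : set (Rn R d) :=
  [set x | forall i,
    coordRn x i \in Interval (BSide (l i) (a i)) (BSide (~~ r i) (b i))].

Definition rectangles (R : realType) (d c : nat) : set (set (Rn R d)) :=
  [set Q | exists a b : 'I_d -> R, exists l r : 'I_d -> bool,
    [/\ forall i, (a i < b i)%R,
        exists alpha : 'I_c -> R, (forall k, 0 < alpha k)%R /\
          forall i, exists k, (b i - a i)%R = alpha k
      & Q = rectangle a b l r]].

Definition maximal (R : realType) (d c : nat) (g : Rn R d -> \bar R)
    (x : Rn R d) : \bar R :=
  ereal_sup [set (\1_Q x)%:E *
                 ((lebesgue R d Q)^-1 * \int[@lebesgue R d]_(y in Q) `|g y|)
            | Q in @rectangles R d c].

(* maximal c (maximal (c - 1) (... (maximal 1 g))) *)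
Fixpoint iter_maximal (R : realType) (d c : nat) (g : Rn R d -> \bar R) :
    Rn R d -> \bar R :=
  match c with
  | 0 => g
  | c'.+1 => maximal c'.+1 (iter_maximal c' g)
  end.

(* Main.v *)
Require Import Defs.
From mathcomp Require Import all_boot all_order all_algebra.
From mathcomp Require Import boolp reals exp.
From mathcomp Require Import lra ring zify.

(** The averages over rectangles are compared with averages over boxes of a
    dyadic grid, so it is enough to bound, uniformly in its size, the
    corresponding maximal operator on a finite grid, for functions f and w
    there; Fatou's lemma and Jensen's inequality on the cells give the
    inequality on R^d.

    Order the c sidelengths of a box.  Given boxes of average at least lambda
    covering a set U, select greedily, by decreasing longest side, a subfamily
    S_j such that each S_j has at least half of its points outside the
    previous ones, while every box is half covered by selected boxes with a
    longer longest side.  Let S'_j be S_j with its longest sides tripled.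
    After shortening its longest sides to the next sidelength, each box is
    still half covered by the S'_j: so U lies where the maximal function with
    c - 1 sidelengths of the indicator of the union of the S'_j is at least
    1/2.  By induction on c, w(U) is at most a constant times the sum of the
    v(S'_j), with v = M_{c-1} ... M_1 w.  As the average of v on S'_j is at
    most u = M_c v on S_j, the product lambda^p v(S'_j) is controlled by
    |S_j| (avg_{S_j} (f u^{1/p}))^p; the S_j having large disjoint parts, the
    sum over j is controlled by the L^p norm of the unweighted strong maximal
    function of f u^{1/p}.  This is the weak type (p, p) inequality for
    every p > 1, and Marcinkiewicz interpolation concludes. *)

Set Implicit Arguments.
Unset Strict Implicit.
Unset Printing Implicit Defensive.
Import Order.TTheory GRing.Theory Num.Theory.
Local Open Scope ring_scope.

(** * One-dimensional maximal function *)

Section layer_cake.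
Context {R : realType}.

(** Discrete form of (p - p0) d(t^p) = p t^p0 d(t^(p - p0)). Once expanded, it is Young's inequality
    for the product of l^p0 and m^(p - p0), with exponents p / p0 and p / (p - p0). *)
Lemma powR_diff_le (l m p0 p : R) : 0 <= m <= l -> 0 < p0 < p ->
  (p - p0) * (l `^ p - m `^ p) <=
  p * (l `^ p0 * (l `^ (p - p0) - m `^ (p - p0))).
Proof.
move=> /andP[m0 ml] /andP[p00 p0p].
have l0 : 0 <= l by apply: le_trans ml.
have pp : 0 < p by lra.
have r0 : 0 < p - p0 by lra.
have := @conjugate_powR R (l `^ p0) (m `^ (p - p0)) (p / p0) (p / (p - p0))
  (powR_ge0 _ _) (powR_ge0 _ _) (divr_gt0 pp p00) (divr_gt0 pp r0).
rewrite -!powRrM !invf_div.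
have -> : p0 * (p / p0) = p by field; lra.
have -> : (p - p0) * (p / (p - p0)) = p by field; lra.
have -> : p0 / p + (p - p0) / p = 1 by field; lra.
move=> /(_ erefl) H.
have E : l `^ p0 * l `^ (p - p0) = l `^ p.
  by rewrite -powRD; [congr (_ `^ _); lra | apply/implyP; lra].
rewrite (mulrBr (l `^ p0)) E.
have := ler_wpM2l (ltW pp) H.
set a := l `^ p; set b := m `^ p; set cc := _ * m `^ _.
have -> : p * (a * (p0 / p) + b * ((p - p0) / p)) = p0 * a + (p - p0) * b.
  by field; lra.
lra.
Qed.

(** The increments of [Phi] telescope up to the largest level not exceeding [y]; nothing is lost
    when [y] is itself a level. *)
Lemma layer_sum (t : nat -> R) (N : nat) (Phi : R -> R) (y : R) :
  (forall i j, (i <= j <= N)%N -> t i <= t j) -> t 0 = 0 -> 0 <= y ->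
  (forall a b, 0 <= a <= b -> Phi a <= Phi b) -> Phi 0 = 0 ->
  (\sum_(i < N) (Phi (t i.+1) - Phi (t i)) * (t i.+1 <= y)%R%:R <= Phi y) /\
  ((exists2 k, (k <= N)%N & y = t k) ->
   \sum_(i < N) (Phi (t i.+1) - Phi (t i)) * (t i.+1 <= y)%R%:R = Phi y).
Proof.
move=> tm t0 y0 Pm P0.
have tpos i : (i <= N)%N -> 0 <= t i by move=> iN; rewrite -t0; apply: tm.
(* Truncating [y] at [t n] allows an induction on the number of levels. *)
suff H n : (n <= N)%N ->
  (\sum_(i < n) (Phi (t i.+1) - Phi (t i)) * (t i.+1 <= y)%R%:R
     <= Phi (Num.min y (t n))) /\
  ((exists2 k, (k <= N)%N & y = t k) ->
   \sum_(i < n) (Phi (t i.+1) - Phi (t i)) * (t i.+1 <= y)%R%:R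
     = Phi (Num.min y (t n))).
  have [H1 H2] := H N (leqnn N); split.
    apply: le_trans H1 _; apply: Pm.
    by rewrite le_min y0 tpos //= ge_min lexx.
  move=> ky; rewrite (H2 ky); case: ky => k kN ->.
  by rewrite min_l // tm // kN leqnn.
elim: n => [|n IH] nN.
  by rewrite big_ord0 t0 min_r // P0.
have {IH} [H1 H2] := IH (ltnW nN).
have tn : t n <= t n.+1 by apply: tm; rewrite leqnSn.
rewrite big_ord_recr /=; case: (leP (t n.+1) y) => ty.
  rewrite mulr1; split.
    rewrite (min_r (le_trans tn ty)) in H1; lra.
  by move=> /H2 ->; rewrite (min_r (le_trans tn ty)) addrC subrK.
rewrite mulr0 addr0; split.
  apply: le_trans H1 _; apply: Pm.
  rewrite le_min y0 tpos ?(ltnW nN) //=. 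
  by rewrite ge_min lexx.
move=> ky; rewrite (H2 ky); case: ky => k kN yk.
rewrite min_l // yk.
have kn : (k <= n)%N.
  rewrite leqNgt; apply/negP => nk.
  by move: ty; rewrite yk ltNge tm // nk kN.
by apply: tm; rewrite kn ltnW.
Qed.

(** Both sides are cut into layers at the values of [F]: the left one exactly, the right one up to
    an inequality, as a value of [G] may fall between two levels. The weak type hypothesis and
    [powR_diff_le] then compare them layer by layer. *)
Lemma marcinkiewicz (X Y : finType) (F v : X -> R) (G u : Y -> R) (p0 p : R) :
  0 < p0 < p -> (forall x, 0 <= F x) -> (forall y, 0 <= G y) ->
  (forall x, 0 <= v x) -> (forall y, 0 <= u y) ->
  (forall l, 0 < l ->
    l `^ p0 * \sum_(x | l <= F x) v x <= \sum_(y | l <= G y) u y) ->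
  (p - p0) * \sum_x F x `^ p * v x <= p * \sum_y G y `^ (p - p0) * u y.
Proof.
move=> /andP[p00 p0p] F0 G0 v0 u0 H.
have pp : 0 < p by lra.
have r0 : 0 < p - p0 by lra.
pose s := sort <=%R (codom F); pose t i := nth 0 (0 :: s) i.
pose N := size s.
have ss : sorted <=%R (0 :: s).
  have so : sorted <=%R s by apply: sort_sorted; exact: le_total.
  rewrite /= path_min_sorted //.
  by apply/allP => z; rewrite mem_sort => /codomP[x ->].
have tm i j : (i <= j <= N)%N -> t i <= t j.
  move=> /andP[ij jN]; apply: (@sorted_leq_nth _ _ le_trans le_refl) => //.
  by rewrite -[_ \in _]/(i < (size s).+1)%N ltnS (leq_trans ij).
have t0 : t 0 = 0 by [].
have Fk x : exists2 k, (k <= N)%N & F x = t k.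
  have xs : F x \in s by rewrite mem_sort codom_f.
  by exists (index (F x) s).+1; rewrite ?index_mem //= /t /= nth_index.
have tpos i : (i <= N)%N -> 0 <= t i by move=> iN; rewrite -t0; apply: tm.
have Pm q : 0 < q -> forall a b : R, 0 <= a <= b -> a `^ q <= b `^ q.
  move=> q0 a b /andP[a0 ab]; apply: ge0_ler_powR => //; first exact: ltW.
  exact: le_trans ab.
pose D q i := t i.+1 `^ q - t i `^ q.
have -> : \sum_x F x `^ p * v x =
    \sum_(i < N) D p i * \sum_(x | t i.+1 <= F x) v x.
  under [RHS]eq_bigr do rewrite mulr_sumr big_mkcond.
  rewrite exchange_big; apply: eq_bigr => x _.
  have [_ /(_ (Fk x)) <-] := layer_sum tm t0 (F0 x) (Pm p pp)
     (powR0 (lt0r_neq0 pp)).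
  rewrite mulr_suml; apply: eq_bigr => i _; rewrite /D.
  by case: ifP => _; rewrite ?mulr1 // mulr0 mul0r.
apply: (@le_trans _ _ (p * \sum_(i < N) D (p - p0) i *
    \sum_(y | t i.+1 <= G y) u y)); last first.
  rewrite ler_pM2l //.
  under eq_bigr do rewrite mulr_sumr big_mkcond.
  rewrite exchange_big; apply: ler_sum => y _.
  have [Hy _] := layer_sum tm t0 (G0 y) (Pm _ r0) (powR0 (lt0r_neq0 r0)).
  apply: le_trans (ler_wpM2r (u0 y) Hy).
  rewrite mulr_suml; apply: ler_sum => i _; rewrite /D.
  by case: ifP => _; rewrite ?mulr1 // mulr0 mul0r.
rewrite !mulr_sumr; apply: ler_sum => i _.
have iN : (i.+1 <= N)%N by [].
have ti : t i <= t i.+1 by apply: tm; rewrite leqnSn.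
have ti0 := tpos _ (ltnW iN).
(* The hypothesis says nothing at level 0, but there the increments vanish. *)
have [tz|tp] := eqVneq (t i.+1) 0.
  have tz' : t i = 0 by apply/eqP; rewrite eq_le ti0 -tz ti.
  by rewrite /D tz tz' !subrr !mul0r !mulr0.
have {}tp : 0 < t i.+1 by rewrite lt_def tp tpos.
have Di : 0 <= D (p - p0) i by rewrite subr_ge0 Pm // ti0 ti.
have A := @powR_diff_le (t i.+1) (t i) p0 p.
rewrite ti0 ti p00 p0p in A; have {}A := A isT isT.
have B := ler_wpM2l Di (H _ tp); have C := ler_wpM2l (ltW pp) B.
apply: le_trans C; rewrite !mulrA.
apply: ler_wpM2r; first exact: sumr_ge0.
by apply: le_trans A _; rewrite /D mulrAC mulrA.
Qed.
End layer_cake.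

(** * The one-sided maximal function on an interval of integers *)

Section one_dimensional.
Context {R : realType}.

Definition forward_max (n : nat) (h : nat -> R) (k : nat) : R :=
  \big[Num.max/0]_(t < n | (k <= t)%N)
    ((\sum_(k <= i < t.+1) h i) / (t.+1 - k)%:R).

Lemma forward_max_ge0 n h k : 0 <= forward_max n h k.
Proof. exact: bigmax_ge_id. Qed.

Lemma le_forward_max n h k t : (k <= t < n)%N ->
  \sum_(k <= i < t.+1) h i <= (t.+1 - k)%:R * forward_max n h k.
Proof.
move=> /andP[kt tn]; rewrite mulrC -ler_pdivrMr ?ltr0n ?subn_gt0 ?ltnS //.
exact: (@le_bigmax_cond _ _ _ _ (Ordinal tn) (fun t : 'I_n => (k <= t)%N)
  (fun t : 'I_n => (\sum_(k <= i < t.+1) h i) / (t.+1 - k)%:R)).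
Qed.

(* Rising sun: starting from the first point of the level set, the shortest
   interval with average at least [l] lies in the level set. *)
Lemma forward_max_weak n (h : nat -> R) (l : R) : 0 < l ->
  l * \sum_(0 <= k < n | l <= forward_max n h k) 1 <=
  \sum_(0 <= k < n | l <= forward_max n h k) h k.
Proof.
move=> l0; have [j] := ubnP (n - 0)%N.
move: 0%N => m; elim: j m => // j IH m nmj.
have [nm|mn] := leqP n m; first by rewrite !big_geq // mulr0.
have [lm|lm] := ltP (forward_max n h m) l.
  rewrite !(big_ltn_cond mn).
  rewrite (leNgt l (forward_max n h m)) lm /=; apply: IH; lia.
have /bigmax_geP[l0'|[t0 mt0 avg0]] := lm; first by rewrite leNgt l0 in l0'.
have ex : exists t, (m <= t < n)%N && (l * (t.+1 - m)%:R <= \sum_(m <= i < t.+1) h i).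
  exists t0; rewrite mt0 ltn_ord /=.
  by rewrite -ler_pdivlMr // ltr0n subn_gt0 ltnS.
case: (ex_minnP ex) => t /andP[/andP[mt tn] avg] tmin.
have lev k : (m <= k < t.+1)%N -> l <= forward_max n h k.
  move=> /andP[mk kt].
  have ktn : (k <= t < n)%N by rewrite -ltnS kt.
  (* If m < k, the shorter interval [m, k) has average below [l] by minimality of [t], so the rest
     [k, t] has average at least [l]. *)
  have lower : l * (t.+1 - k)%:R <= \sum_(k <= i < t.+1) h i.
    have [->//|mk'] := eqVneq k m.
    have : ~~ (l * (k - m)%:R <= \sum_(m <= i < k) h i).
      apply/negP => kk; have := tmin k.-1.
      rewrite prednK; last by lia.
      rewrite kk andbT => /(_ _); lia.
    rewrite -ltNge => kl.
    move: avg; rewrite (big_cat_nat (n := k)) //=; last by lia.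
    have -> : (t.+1 - m)%:R = (k - m)%:R + (t.+1 - k)%:R :> R.
      by rewrite -natrD; congr _%:R; lia.
    rewrite mulrDr; lra.
  have := le_trans lower (le_forward_max h ktn); rewrite mulrC ler_pM2l // ltr0n; lia.
rewrite (big_cat_nat (n := t.+1)) //=; last by lia.
rewrite [in leRHS](big_cat_nat (n := t.+1)) //=; last by lia.
rewrite mulrDr; apply: lerD; last by apply: IH; lia.
have E (F : nat -> R) : \sum_(m <= k < t.+1 | l <= forward_max n h k) F k =
    \sum_(m <= k < t.+1) F k.
  rewrite big_nat_cond [RHS]big_nat; apply: eq_bigl => k.
  by case: (boolP (m <= k < t.+1)%N) => // mkt; rewrite lev.
by rewrite !E sumr_const_nat.
Qed.

(** Interpolation with p0 = 1 bounds the sum S of the p-th powers of the maximal function by q times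
    the sum of its (p - 1)-th powers against [h]. Half of S is then absorbed by the left-hand
    side. *)
Lemma forward_max_strong (p : R) : 1 < p -> exists2 C : R, 0 < C &
  forall n (h : nat -> R), (forall k, 0 <= h k) ->
    \sum_(0 <= k < n) forward_max n h k `^ p <= C * \sum_(0 <= k < n) h k `^ p.
Proof.
move=> p1; pose q := p / (p - 1).
have q0 : 0 < q by apply: divr_gt0; lra.
have q20 : 0 < 2 * q by lra.
exists (2 * (q * (2 * q) `^ (p - 1))).
  apply: mulr_gt0 => //; apply: mulr_gt0 => //; exact: powR_gt0.
move=> n h h0.
have p01 : (0 : R) < 1 < p by rewrite ltr01.
have := @marcinkiewicz R 'I_n 'I_n (fun k => forward_max n h k) (fun=> 1)
  (fun k => forward_max n h k) (fun k => h k) 1 p.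
move=> /(_ p01 (fun k => forward_max_ge0 n h k) (fun k => forward_max_ge0 n h k)
  (fun=> ler01) (fun k => h0 k)) H.
have {H} : (p - 1) * \sum_(k < n) forward_max n h k `^ p * 1 <=
    p * \sum_(k < n) forward_max n h k `^ (p - 1) * h k.
  apply: H => l l0; rewrite powRr1 ?(ltW l0) //.
  have := forward_max_weak n h l0.
  by rewrite !big_mkord.
under eq_bigr do rewrite mulr1.
rewrite !big_mkord => H.
set S := \sum_(k < n) forward_max n h k `^ p in H *.
set T := \sum_(k < n) h k `^ p.
have {}H : S <= q * \sum_(k < n) forward_max n h k `^ (p - 1) * h k.
  by rewrite /q mulrAC ler_pdivlMr; [rewrite mulrC | lra].
(* Either a <= 2 q b, and the second term suffices, or q b < a / 2, and the first one does: the
   threshold is chosen to leave the coefficient 1/2 to be absorbed. *)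
have young a b : 0 <= a -> 0 <= b -> q * (a `^ (p - 1) * b) <=
    2^-1 * a `^ p + q * (2 * q) `^ (p - 1) * b `^ p.
  move=> a0 b0.
  have pa : 0 <= p - 1 by lra.
  have E c : 0 <= c -> c `^ p = c `^ (p - 1) * c.
    by move=> c0; rewrite mulrC mulr_powRB1 //; lra.
  have [ab|ab] := leP a (2 * q * b).
    apply: (@le_trans _ _ (q * ((2 * q) `^ (p - 1) * b `^ p))).
      rewrite ler_pM2l // (E b) // mulrA ler_wpM2r //.
      rewrite -powRM //; last by apply: ltW.
      have qb : 0 <= 2 * q * b by apply: mulr_ge0 => //; apply: ltW.
      by apply: ge0_ler_powR.
    by rewrite mulrA ler_wpDl // mulr_ge0 ?powR_ge0 // invr_ge0.
  apply: (@le_trans _ _ (2^-1 * a `^ p)).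
    rewrite (E a) //.
    rewrite mulrCA [leRHS]mulrCA ler_wpM2l ?powR_ge0 //; lra.
  rewrite lerDl; apply: mulr_ge0; last exact: powR_ge0.
  by apply: mulr_ge0; [exact: ltW | exact: powR_ge0].
have : S <= 2^-1 * S + q * (2 * q) `^ (p - 1) * T.
  apply: le_trans H _; rewrite /S /T !mulr_sumr -big_split /=.
  by apply: ler_sum => k _; apply: young; rewrite ?forward_max_ge0.
set K := q * _; lra.
Qed.

End one_dimensional.

(** * Intervals on both sides of a point *)

Section two_sided.
Context {R : realType}.

Lemma powRD_le (p x y : R) : 0 <= p -> 0 <= x -> 0 <= y ->
  (x + y) `^ p <= 2 `^ p * (x `^ p + y `^ p).
Proof.
move=> p0 x0 y0; wlog xy : x y x0 y0 / x <= y.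
  move=> H; have [/H|/ltW /H] := leP x y; first exact.
  by rewrite [y + x]addrC [y `^ p + _]addrC; apply.
apply: (@le_trans _ _ ((2 * y) `^ p)).
  by apply: ge0_ler_powR; rewrite ?nnegrE //; lra.
rewrite powRM // ler_wpM2l ?powR_ge0 // lerDr; exact: powR_ge0.
Qed.

(** A majorant of the two-sided maximal function: the reflection [n.-1 - i] turns intervals ending
    at [k] into intervals starting at its mirror image. *)
Definition interval_max (n : nat) (h : nat -> R) (k : nat) : R :=
  forward_max n h k + forward_max n (fun i => h (n.-1 - i)%N) (n.-1 - k)%N.

Lemma interval_max_ge0 n h k : 0 <= interval_max n h k.
Proof. by rewrite addr_ge0 ?forward_max_ge0. Qed.

Lemma le_interval_max n h k a b : (forall i, 0 <= h i) -> (a <= k < b)%N -> (b <= n)%N ->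
  \sum_(a <= i < b) h i <= (b - a)%:R * interval_max n h k.
Proof.
move=> h0 /andP[ak kb] bn.
have right : \sum_(k <= i < b) h i <= (b - k)%:R * forward_max n h k.
  have := @le_forward_max R n h k b.-1; rewrite prednK; last by lia.
  by apply; lia.
have left : \sum_(a <= i < k.+1) h i <=
    (k.+1 - a)%:R * forward_max n (fun i => h (n.-1 - i)%N) (n.-1 - k)%N.
  have := @le_forward_max R n (fun i => h (n.-1 - i)%N) (n.-1 - k)%N (n.-1 - a)%N.
  have -> : ((n.-1 - a).+1 - (n.-1 - k) = k.+1 - a)%N by lia.
  suff -> : \sum_(n.-1 - k <= i < (n.-1 - a).+1) h (n.-1 - i)%N =
    \sum_(a <= i < k.+1) h i by apply; lia.
  rewrite [RHS]big_nat_rev /= -[X in _ = \sum_(X <= _ < _) _]add0n big_addn.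
  rewrite -[X in \sum_(X <= _ < _) _ = _]add0n big_addn.
  have -> : ((n.-1 - a).+1 - (n.-1 - k) = k.+1 - a)%N by lia.
  by apply: eq_big_nat => i ik; congr h; lia.
have kk : 0 <= \sum_(a <= i < k) h i by apply: sumr_ge0.
have -> : \sum_(a <= i < b) h i = \sum_(a <= i < k) h i + \sum_(k <= i < b) h i.
  by rewrite (big_cat_nat (n := k)) //=; lia.
(* Both halves contain [k]; its term is dropped from the left one. *)
rewrite big_nat_recr //= in left.
have {}left : \sum_(a <= i < k) h i <=
    (k.+1 - a)%:R * forward_max n (fun i => h (n.-1 - i)%N) (n.-1 - k)%N.
  by have := h0 k; lra.
apply: le_trans (lerD left right) _.
rewrite /interval_max mulrDr addrC; apply: lerD.
  by apply: ler_wpM2r; [exact: forward_max_ge0 | rewrite ler_nat; lia].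
by apply: ler_wpM2r; [exact: forward_max_ge0 | rewrite ler_nat; lia].
Qed.

Lemma interval_max_strong (p : R) : 1 < p -> exists2 C : R, 0 < C &
  forall n (h : nat -> R), (forall k, 0 <= h k) ->
    \sum_(0 <= k < n) interval_max n h k `^ p <= C * \sum_(0 <= k < n) h k `^ p.
Proof.
move=> p1; have [C C0 HC] := forward_max_strong p1.
have p0 : 0 <= p by lra.
exists (2 `^ p * (C + C)).
  by apply: mulr_gt0; [exact: powR_gt0 | lra].
move=> n h h0.
have rev (F : nat -> R) : \sum_(0 <= k < n) F (n.-1 - k)%N = \sum_(0 <= k < n) F k.
  rewrite [RHS]big_nat_rev /=; apply: eq_big_nat => i ik; congr F; lia.
apply: (@le_trans _ _ (\sum_(0 <= k < n) 2 `^ p * (forward_max n h k `^ p +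
   forward_max n (fun i => h (n.-1 - i)%N) (n.-1 - k)%N `^ p))).
  by apply: ler_sum => k _; apply: powRD_le; rewrite ?forward_max_ge0.
rewrite -mulr_sumr big_split /= -mulrA ler_wpM2l ?powR_ge0 // mulrDl.
apply: lerD; first exact: HC.
rewrite (rev (fun k => forward_max n (fun i => h (n.-1 - i)%N) k `^ p)).
apply: le_trans (HC _ _ _) _ => //.
by rewrite (rev (fun k => h k `^ p)).
Qed.

End two_sided.

(** * The strong maximal function on a finite grid *)

Section strong_maximal.
Context {R : realType} {d M : nat}.
Local Notation X := {ffun 'I_d -> 'I_M}.

Definition upd (x : X) (i : 'I_d) (t : 'I_M) : X :=
  [ffun j => if j == i then t else x j].

Lemma upd_same x i t : upd x i t i = t.
Proof. by rewrite ffunE eqxx. Qed.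

Lemma upd_upd x i t t' : upd (upd x i t) i t' = upd x i t'.
Proof. by apply/ffunP => j; rewrite !ffunE; case: (j == i). Qed.

Lemma upd_id x i : upd x i (x i) = x.
Proof. by apply/ffunP => j; rewrite !ffunE; case: eqP => [->|]. Qed.

(** The map sending (x, t) to ([upd x i t], [x i]) is an involution, so every point is reached M
    times. This cuts sums over the grid into lines parallel to axis [i]. *)
Lemma sum_upd (G : X -> R) i :
  \sum_x \sum_t G (upd x i t) = M%:R * \sum_x G x.
Proof.
rewrite pair_big /=.
rewrite (reindex_inj (h := fun z : X * 'I_M => (upd z.1 i z.2, z.1 i))) /=.
  under eq_bigr do rewrite upd_upd upd_id.
  rewrite -(pair_big predT predT (fun (x : X) (t : 'I_M) => G x)) /=.
  under eq_bigr do rewrite sumr_const card_ord -mulr_natl.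
  by rewrite -mulr_sumr.
apply: (can_inj (g := fun z : X * 'I_M => (upd z.1 i z.2, z.1 i))) => -[x t] /=.
by rewrite upd_same upd_upd upd_id.
Qed.

(** The restriction of [h] to a line, extended by 0 to all naturals to suit [interval_max]. *)
Definition line (h : X -> R) (x : X) (i : 'I_d) (t : nat) : R :=
  oapp (fun t : 'I_M => h (upd x i t)) 0 (insub t).

Lemma lineE h x i (t : 'I_M) : line h x i t = h (upd x i t).
Proof. by rewrite /line valK. Qed.

Lemma line_upd h x i t : line h (upd x i t) i = line h x i.
Proof.
apply: funext => s; rewrite /line; case: insub => //= u.
by rewrite upd_upd.
Qed.

Definition directional_max (i : 'I_d) (h : X -> R) (x : X) : R :=
  interval_max M (line h x i) (x i).

Lemma directional_max_ge0 i h x : 0 <= directional_max i h x.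
Proof. exact: interval_max_ge0. Qed.

Lemma line_ge0 (h : X -> R) x i t : (forall x, 0 <= h x) -> 0 <= line h x i t.
Proof. by move=> h0; rewrite /line; case: (insub t) => [u|] /=. Qed.

Lemma le_directional_max (i : 'I_d) (h : X -> R) (x : X) a b : (forall x, 0 <= h x) ->
  (a <= x i < b)%N -> (b <= M)%N ->
  \sum_(t : 'I_M | (a <= t < b)%N) h (upd x i t) <= (b - a)%:R * directional_max i h x.
Proof.
move=> h0 xab bM.
have := @le_interval_max R M (line h x i) (x i) a b (fun t => line_ge0 _ _ _ h0) xab bM.
suff -> : \sum_(a <= t < b) line h x i t =
  \sum_(t : 'I_M | (a <= t < b)%N) h (upd x i t) by [].
rewrite (big_nat_widen _ _ M) // (big_nat_widenl _ 0) // big_mkord.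
by apply: eq_big => t; [rewrite andbC | rewrite lineE].
Qed.

(** One-dimensional maximal functions composed over all axes: a majorant of the averages over all
    boxes through the point that inherits its L^p bound from dimension one. *)
Definition strong_max (h : X -> R) : X -> R := foldr directional_max h (enum 'I_d).

Lemma foldr_directional_max_ge0 l (h : X -> R) x : (forall x, 0 <= h x) ->
  0 <= foldr directional_max h l x.
Proof. by case: l => [|i l] h0 //=; exact: directional_max_ge0. Qed.

(** Fubini, one axis at a time: the coordinates outside [l] are frozen at those of [x], the inner
    sums are bounded at the points [upd x i t] by induction, and the remaining sum over t is
    one-dimensional. *)
Lemma foldr_directional_max_ge (s n : 'I_d -> nat) (h : X -> R) (l : seq 'I_d) (x : X) :
  (forall x, 0 <= h x) -> uniq l -> (forall i, s i + n i <= M)%N ->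
  (forall i, s i <= x i < s i + n i)%N ->
  \sum_(y : X | [forall i, if i \in l then (s i <= y i < s i + n i)%N
                           else y i == x i]) h y <=
  (\prod_(i <- l) (n i)%:R) * foldr directional_max h l x.
Proof.
move=> h0 + snM; elim: l x => [|i l IH] x /=.
  move=> _ xR; rewrite big_nil mul1r (big_pred1 x) // => y /=.
  apply/forallP/eqP => [yx|-> i]; last by [].
  by apply/ffunP => i; apply/eqP/yx.
move=> /andP[il ul] xR.
rewrite (partition_big (fun y : X => y i)
  (fun t : 'I_M => (s i <= t < s i + n i)%N)) /=; last first.
  by move=> y /forallP/(_ i); rewrite inE eqxx.
apply: (@le_trans _ _ (\sum_(t : 'I_M | (s i <= t < s i + n i)%N)
   (\prod_(j <- l) (n j)%:R) * foldr directional_max h l (upd x i t))).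
  apply: ler_sum => t ti.
  apply: le_trans (IH (upd x i t) ul _); last first.
    by move=> j; rewrite ffunE; case: eqP => [->|].
  rewrite le_eqVlt; apply/orP; left; apply/eqP; apply: eq_bigl => y.
  apply/andP/forallP => [[/forallP yR /eqP yi] j|yR].
    have := yR j; rewrite inE ffunE; have [->|//] := eqVneq j i.
    by rewrite (negbTE il) yi eqxx.
  have yi : y i = t by have := yR i; rewrite (negbTE il) upd_same => /eqP.
  split; last exact/eqP.
  apply/forallP => j; have := yR j; rewrite inE ffunE.
  by have [->|//] := eqVneq j i; rewrite yi.
rewrite -mulr_sumr big_cons [(n i)%:R * _]mulrC -mulrA.
apply: ler_wpM2l; first by apply: prodr_ge0.
apply: le_trans (le_directional_max _ (xR i) (snM i)) _.
  by move=> y; exact: foldr_directional_max_ge0.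
by rewrite addKn.
Qed.

Lemma le_strong_max (s n : 'I_d -> nat) (h : X -> R) (x : X) :
  (forall x, 0 <= h x) -> (forall i, s i + n i <= M)%N ->
  (forall i, s i <= x i < s i + n i)%N ->
  \sum_(y : X | [forall i, (s i <= y i < s i + n i)%N]) h y <=
  (\prod_i (n i)%:R) * strong_max h x.
Proof.
move=> h0 snM xR; have := foldr_directional_max_ge h0 (enum_uniq 'I_d) snM xR.
rewrite big_enum /=; apply: le_trans.
rewrite le_eqVlt; apply/orP; left; apply/eqP; apply: eq_bigl => y.
by apply: eq_forallb => i; rewrite mem_enum.
Qed.

End strong_maximal.

(** The one-dimensional inequality holds on each line with the same constant; multiplying both sides
    by M lets [sum_upd] turn them into sums over lines. *)
Lemma directional_max_strong {R : realType} (p : R) : 1 < p -> exists2 C : R, 0 < C &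
  forall d M (i : 'I_d) (h : {ffun 'I_d -> 'I_M} -> R), (forall x, 0 <= h x) ->
    \sum_x directional_max i h x `^ p <= C * \sum_x h x `^ p.
Proof.
move=> p1; have [C C0 HC] := interval_max_strong p1; exists C => // d M i h h0.
have [M0|M0] := posnP M.
  by subst M; rewrite !big1 ?mulr0 // => x; case: (x i).
have M0' : 0 < M%:R :> R by rewrite ltr0n.
rewrite -(ler_pM2l M0') [leRHS]mulrCA -(sum_upd _ i).
rewrite -(sum_upd (fun x => h x `^ p) i) mulr_sumr.
apply: ler_sum => x _.
have E (t : 'I_M) : directional_max i h (upd x i t) = interval_max M (line h x i) t.
  by rewrite /directional_max line_upd upd_same.
have := HC M (line h x i) (fun t => line_ge0 _ _ _ h0); rewrite !big_mkord.
under [in X in _ <= X -> _]eq_bigr do rewrite lineE.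
by under [in X in _ -> X]eq_bigr do rewrite E.
Qed.

Lemma strong_max_strong {R : realType} (d : nat) (p : R) : 1 < p ->
  exists2 C : R, 0 < C &
  forall M (h : {ffun 'I_d -> 'I_M} -> R), (forall x, 0 <= h x) ->
    \sum_x strong_max h x `^ p <= C * \sum_x h x `^ p.
Proof.
move=> p1; have [C C0 HC] := directional_max_strong p1.
exists (C ^+ size (enum 'I_d)); first exact: exprn_gt0.
move=> M h h0; rewrite /strong_max; elim: (enum 'I_d) => [|i l IH] /=.
  by rewrite expr0 mul1r.
apply: le_trans (HC _ _ _ _ _) _; first by move=> x; exact: foldr_directional_max_ge0.
by rewrite exprS -mulrA ler_pM2l.
Qed.

(** * Boxes, covering and the weighted discrete inequality *)

Section selection.

(* The set [E j] is the part of [Q j] outside the sets selected before it. *)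
Lemma greedy_selection (T I : finType) (Q : I -> {set T}) (l : I -> nat)
    (U : {set I}) :
  exists (J : {set I}) (E : I -> {set T}),
    [/\ J \subset U,
        (forall j, j \in J -> E j \subset Q j /\ (#|Q j| <= 2 * #|E j|)%N),
        (forall i j, i \in J -> j \in J -> i != j -> [disjoint E i & E j])
      & forall i, i \in U ->
          (#|Q i| <= 2 * #|Q i :&: \bigcup_(j in J | (l i <= l j)%N) Q j|)%N].
Proof.
have [n] := ubnP #|U|; elim: n U => // n IH U Un.
have [->|[i0 i0U]] := set_0Vmem U.
  exists set0, (fun=> set0); split => // [j|i j|i]; by rewrite inE.
(* The set with the smallest label is examined last: every set selected before it then has a label
   at least as large. *)
case: (arg_minnP l i0U) => i /= iU0 imin.
have iU : i \in U by [].
have [|J [E [JU EJ dE cov]]] := IH (U :\ i).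
  by move: Un; rewrite (cardsD1 i U) iU add1n ltnS.
have JU' : J \subset U by apply: subset_trans JU (subsetDl _ _).
have Jl j : j \in J -> (l i <= l j)%N by move=> /(subsetP JU')/imin.
have [Qi|Qi] := leqP #|Q i| (2 * #|Q i :&: \bigcup_(j in J) Q j|).
  exists J, E; split => // k kU; have [->|ki] := eqVneq k i.
    apply: leq_trans Qi _; rewrite leq_mul2l subset_leq_card //.
    apply: setIS; apply/bigcupsP => j jJ.
    by apply: (bigcup_max j) => //; rewrite jJ Jl.
  by apply: cov; rewrite !inE ki.
(* Less than half of [Q i] is covered, so it is selected and keeps its uncovered part. *)
exists (i |: J), (fun j => if j == i then Q i :\: \bigcup_(j in J) Q j else E j).
have iJ : i \notin J.
  by apply/negP => /(subsetP JU); rewrite !inE eqxx.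
have neJ j : j \in J -> (j == i) = false.
  by move=> jJ; apply/negbTE; apply: contraNneq iJ => <-.
have dis j : j \in J -> [disjoint Q i :\: \bigcup_(j in J) Q j & E j].
  move=> jJ; rewrite disjoint_sym; have [EQ _] := EJ _ jJ.
  apply: disjointWl EQ _.
  rewrite -setI_eq0; apply/eqP/setP => x; rewrite !inE.
  apply/negbTE/negP => /and3P[xQ xJ _]; case/negP: xJ.
  by apply/bigcupP; exists j.
split.
- by apply/subsetP => j; rewrite !inE => /orP[/eqP ->|/(subsetP JU')].
- move=> j; rewrite !inE; case: eqVneq => [-> _|_ /= /EJ //].
  split; first exact: subsetDl.
  by move: Qi; rewrite -(cardsID (\bigcup_(j in J) Q j) (Q i)); lia.
- move=> a b; rewrite !inE.
  case: (eqVneq a i) => [->|ai] /=; case: (eqVneq b i) => [->|bi] //=.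
  + by move=> _ bJ _; exact: dis.
  + by move=> aJ _ _; rewrite disjoint_sym; exact: dis.
  + exact: dE.
- move=> k kU; have [->|ki] := eqVneq k i.
    rewrite (setIidPl _); first by lia.
    by apply: (bigcup_max i); rewrite // !inE eqxx leqnn.
  apply: leq_trans (cov k _) _; first by rewrite !inE ki.
  rewrite leq_mul2l subset_leq_card //.
  apply: setIS; apply/bigcupsP => j /andP[jJ kj].
  by apply: (bigcup_max j) => //; rewrite !inE jJ orbT.
Qed.

Lemma sum_disjoint_le {R : realDomainType} (T I : finType) (J : {set I})
    (E : I -> {set T}) (g : T -> R) :
  (forall x, 0 <= g x) ->
  (forall i j, i \in J -> j \in J -> i != j -> [disjoint E i & E j]) ->
  \sum_(j in J) \sum_(x in E j) g x <= \sum_x g x.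
Proof.
move=> g0 dE; rewrite (exchange_big_dep predT) //=.
apply: ler_sum => x _.
case: (pickP [pred j in J | x \in E j]) => [j /= /andP[jJ xj]|none].
  rewrite (big_pred1 j) // => k /=; apply/andP/eqP => [[kJ xk]|-> //].
  apply/eqP; apply/negPn/negP => kj.
  by have /disjointFr/(_ xk) := dE _ _ kJ jJ kj; rewrite xj.
by rewrite big_pred0.
Qed.

End selection.

(** * Boxes and maximal operators on the grid *)

Section boxes.
Context {R : realType} {d M : nat}.
Local Notation X := {ffun 'I_d -> 'I_M}.

Definition box (s n : 'I_d -> nat) : {set X} :=
  [set x : X | [forall i, (s i <= x i < s i + n i)%N]].

Lemma in_box s n (x : X) :
  reflect (forall i, (s i <= x i < s i + n i)%N) (x \in box s n).
Proof. by rewrite inE; apply: forallP. Qed.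

Lemma card_box s n : (forall i, s i + n i <= M)%N ->
  #|box s n| = (\prod_i n i)%N.
Proof.
move=> snM.
pose F i := [pred k : 'I_M | (s i <= k < s i + n i)%N].
have -> : #|box s n| = #|family F|.
  by apply: eq_card => x; rewrite inE; apply: eq_forallb => i; rewrite inE.
rewrite card_family foldrE big_image /=; apply: eq_bigr => i _.
rewrite -sum1_card.
rewrite (eq_bigl (fun k : 'I_M => (s i <= k < s i + n i)%N)) //.
rewrite -(big_mkord (fun k => (s i <= k < s i + n i)%N) (fun=> 1%N)).
transitivity (\sum_(s i <= k < s i + n i) 1)%N; last first.
  by rewrite sum_nat_const_nat addKn muln1.
rewrite [RHS](big_nat_widen _ _ M) ?snM // [RHS](big_nat_widenl _ 0) //.
by apply: eq_bigl => k; rewrite andbC.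
Qed.

Definition avg (B : {set X}) (f : X -> R) : R := (\sum_(x in B) f x) / #|B|%:R.

Lemma avg_ge0 (B : {set X}) (f : X -> R) : (forall x, 0 <= f x) -> 0 <= avg B f.
Proof. by move=> f0; rewrite divr_ge0 // sumr_ge0. Qed.

Lemma avgE (B : {set X}) (f : X -> R) : \sum_(x in B) f x = #|B|%:R * avg B f.
Proof.
have [B0|B0] := posnP #|B|.
  by rewrite (cards0_eq B0) big_set0 cards0 mul0r.
by rewrite /avg mulrC divfK // pnatr_eq0 -lt0n.
Qed.

(* The side of a box in direction [i] is [alpha (pi i)], where [alpha] is
   nondecreasing: the boxes with [c] ordered sidelengths are those for which
   [pi] takes its values in [1, c], and those for [pi = 0] are points. *)
Definition sorted_box (pi : 'I_d -> nat) (B : {set X}) : Prop :=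
  exists (alpha : nat -> nat) (s : 'I_d -> nat),
    [/\ alpha 0 = 1%N, {homo alpha : i j / (i <= j)%N},
        forall i, (s i + alpha (pi i) <= M)%N
      & B = box s (fun i => alpha (pi i))].

Definition side_pattern (c : nat) (pi : 'I_d -> nat) : bool :=
  [forall i, ((0 < c) <= pi i <= c)%N].

Definition box_of_complexity (c : nat) (B : {set X}) : Prop :=
  exists2 pi, side_pattern c pi & sorted_box pi B.

Definition grid_maximal (c : nat) (f : X -> R) (x : X) : R :=
  \big[Num.max/0]_(B : {set X} | `[<box_of_complexity c B>] && (x \in B)) avg B f.

Fixpoint iter_grid_maximal (c : nat) (f : X -> R) : X -> R :=
  if c is c'.+1 then grid_maximal c (iter_grid_maximal c' f) else f.

Lemma grid_maximal_ge0 c (f : X -> R) x : 0 <= grid_maximal c f x.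
Proof. exact: bigmax_ge_id. Qed.

Lemma le_grid_maximal c (f : X -> R) (B : {set X}) x :
  box_of_complexity c B -> x \in B -> avg B f <= grid_maximal c f x.
Proof.
move=> cB xB; apply: (le_bigmax_cond _ (fun B => avg B f)).
by rewrite xB andbT; apply/asboolP.
Qed.

Lemma grid_maximal_attained c (f : X -> R) (x : X) : (exists2 B, box_of_complexity c B & x \in B) ->
  (forall x, 0 <= f x) ->
  exists B, [/\ box_of_complexity c B, x \in B & grid_maximal c f x = avg B f].
Proof.
move=> [B0 cB0 xB0] f0.
have : grid_maximal c f x <= grid_maximal c f x by [].
(* If the maximum is the default value 0, any box through [x] attains it, since averages of [f] are
   nonnegative. *)
rewrite {2}/grid_maximal => /bigmax_geP[m0|[B /andP[/asboolP cB xB] m]].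
  exists B0; split=> //; apply/le_anti; rewrite le_grid_maximal // andbT.
  exact: le_trans m0 (avg_ge0 _ f0).
by exists B; split => //; apply/le_anti; rewrite m le_grid_maximal.
Qed.

Lemma iter_grid_maximal_ge0 c (f : X -> R) x : (forall x, 0 <= f x) -> 0 <= iter_grid_maximal c f x.
Proof. by case: c => [|c] f0 //=; exact: grid_maximal_ge0. Qed.

Lemma avg_le_strong_max pi (B : {set X}) (f : X -> R) x :
  (forall x, 0 <= f x) -> sorted_box pi B -> x \in B -> avg B f <= strong_max f x.
Proof.
move=> f0 [alpha [s [a0 am snM ->]]] xB.
have B0 : (0 < #|box s (fun i => alpha (pi i))|)%N by apply/card_gt0P; exists x.
rewrite ler_pdivrMr ?ltr0n //.
have := le_strong_max f0 snM (elimT (in_box _ _ _) xB).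
rewrite -natr_prod -(card_box snM) mulrC.
by apply: le_trans; rewrite le_eqVlt; apply/orP; left; apply/eqP; apply: eq_bigl => y; rewrite inE.
Qed.

(* The equality holds because swapping the coordinates in [A] is an involution
   of [B * B']. *)
Lemma cylinder_count (A : {set 'I_d}) (B B' C : {set X}) :
  let mix (y z : X) : X := [ffun i => if i \in A then z i else y i] in
  (forall y z, y \in B -> z \in B' -> mix z y \in B /\ mix y z \in B') ->
  (forall y z, y \in C -> z \in B' -> mix y z \in C) ->
  (forall y z, z \in C -> y \in B -> mix z y \in C) ->
  (#|B :&: C| * #|B'| = #|B| * #|B' :&: C|)%N.
Proof.
move=> mix swap cyl cyl'.
rewrite -!cardsX.
pose sw (z : X * X) := (mix z.2 z.1, mix z.1 z.2).
have swK : involutive sw.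
  move=> [y z]; rewrite /sw /mix /=.
  by congr pair; apply/ffunP => i; rewrite !ffunE; case: (i \in A).
rewrite -(card_imset _ (inv_inj swK)).
congr #|pred_of_set _|; apply/setP => -[y z]; apply/imsetP/idP.
  move=> [[y' z']]; rewrite !inE /= => /andP[/andP[yB yC] zB] [-> ->].
  have [-> ->] := swap _ _ yB zB.
  by rewrite cyl.
rewrite !inE /= => /andP[yB /andP[zB zC]].
exists (sw (y, z)); last by rewrite swK.
rewrite !inE /=.
have [-> ->] := swap _ _ yB zB.
by rewrite cyl'.
Qed.

End boxes.

(** * Shrinking and dilating the longest sides *)

Section covering.
Context {d M : nat}.
Local Notation X := {ffun 'I_d -> 'I_M}.

(* Shrinking the longest sides of a box to the next sidelength keeps the
   proportion of a set that is a cylinder along these sides. *)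
Lemma subbox_half c (pi s : 'I_d -> nat) (alpha : nat -> nat) (x : X) (D G : {set X}) :
  let Q := box s (fun i => alpha (pi i)) in
  side_pattern c.+1 pi -> alpha 0 = 1%N -> {homo alpha : i j / (i <= j)%N} ->
  (forall i, s i + alpha (pi i) <= M)%N -> x \in Q ->
  (#|Q| <= 2 * #|Q :&: D|)%N ->
  (forall y z, y \in Q :&: D -> z \in Q ->
     (forall i, pi i != c.+1 -> z i = y i) -> z \in G) ->
  exists Q' : {set X}, [/\ sorted_box (fun i => minn (pi i) c) Q', x \in Q'
    & (#|Q'| <= 2 * #|Q' :&: G|)%N].
Proof.
move=> Q /forallP tpi a0 am sM xQ QD DG.
have apos k : (0 < alpha k)%N by have := am 0%N k isT; rewrite a0.
have ac := am _ _ (leqnSn c).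
(* A shortened side starts at [x i], or as far right as still fits inside [Q]. *)
pose s' i := if pi i == c.+1 then minn (x i) (s i + alpha c.+1 - alpha c) else s i.
have s'M i : (s i <= s' i)%N /\ (s' i + alpha (minn (pi i) c) <= s i + alpha (pi i))%N.
  have /in_box/(_ i) := xQ; rewrite /s'; case: eqVneq => [->|pc].
    by rewrite (minn_idPr (leqnSn c)); lia.
  have -> : minn (pi i) c = pi i by have := tpi i; lia.
  by lia.
pose Q' := box s' (fun i => alpha (minn (pi i) c)) : {set X}.
have xQ' : x \in Q'.
  apply/in_box => i; have /in_box/(_ i) := xQ; rewrite /s'.
  have := apos (minn (pi i) c); case: eqVneq => [->|pc].
    by rewrite (minn_idPr (leqnSn c)); have := apos c; lia.
  by have -> : minn (pi i) c = pi i by have := tpi i; lia.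
have Q'Q : Q' \subset Q.
  apply/subsetP => y /in_box yQ'; apply/in_box => i.
  by have := yQ' i; have := s'M i; lia.
have low i : pi i != c.+1 -> s' i = s i /\ minn (pi i) c = pi i.
  by move=> pc; rewrite /s' (negbTE pc); split => //; have := tpi i; lia.
exists Q'; split => //.
  exists alpha, s'; split => // i.
  by have := s'M i; have := sM i; lia.
(* The cylinder over [Q :&: D] along the longest sides. It has the same density in [Q] and in [Q'],
   and [DG] puts its trace on [Q'] inside [G]. *)
pose C := [set z : X | [exists y in Q :&: D, forall i, (pi i != c.+1) ==> (z i == y i)]].
have inC (z : X) : reflect (exists2 y, y \in Q :&: D & forall i, pi i != c.+1 -> z i = y i)
    (z \in C).
  rewrite inE; apply: (iffP exists_inP) => -[y yD yz]; exists y => //.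
    by move=> i pi_c; apply/eqP; have /forallP/(_ i)/implyP := yz; apply.
  by apply/forallP => i; apply/implyP => /yz ->.
have := @cylinder_count d M [set i | pi i == c.+1] Q Q' C.
move=> /(_ _ _ _) H.
have {}H : (#|Q :&: C| * #|Q'| = #|Q| * #|Q' :&: C|)%N.
  apply: H.
  - move=> y z /in_box yQ /in_box zQ'; split; apply/in_box => i; rewrite ffunE inE.
      have [pc|pc] := eqVneq (pi i) c.+1; first exact: yQ.
      by have [s1 m1] := low i pc; have := zQ' i; rewrite s1 m1.
    have [pc|pc] := eqVneq (pi i) c.+1; first exact: zQ'.
    by have [-> ->] := low i pc; exact: yQ.
  - move=> y z /inC[y' y'D yy'] _; apply/inC; exists y' => // i pc.
    by rewrite ffunE inE (negbTE pc) yy'.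
  - move=> y z /inC[y' y'D yy'] _; apply/inC; exists y' => // i pc.
    by rewrite ffunE inE (negbTE pc) yy'.
have Q0 : (0 < #|Q|)%N by apply/card_gt0P; exists x.
have QC : (#|Q :&: D| <= #|Q :&: C|)%N.
  apply: subset_leq_card; apply/subsetP => y yQD; rewrite inE.
  have [yQ _] := setIP yQD; rewrite yQ /=.
  by apply/inC; exists y.
have Q'C : (#|Q' :&: C| <= #|Q' :&: G|)%N.
  apply: subset_leq_card; apply/subsetP => z /setIP[zQ' /inC[y yQD zy]].
  by rewrite inE zQ' (DG y) // (subsetP Q'Q).
rewrite -(leq_pmul2l Q0); apply: (@leq_trans (2 * #|Q :&: C| * #|Q'|)).
  by rewrite leq_mul2r; apply/orP; right; lia.
by rewrite -mulnA H mulnCA leq_mul2l; apply/orP; right; rewrite leq_mul2l Q'C orbT.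
Qed.

(** A box that meets [S] and whose longest sides are not longer than those of [S] stays, along these
    directions, within distance l of [S]. Tripling those sides of [S], up to the edge of the grid,
    thus catches every [z] obtained from a common point by moving inside that box along them. *)
Lemma star_box c (pi s : 'I_d -> nat) (alpha : nat -> nat) :
  let S : {set X} := box s (fun i => alpha (pi i)) in
  side_pattern c.+1 pi -> alpha 0 = 1%N -> {homo alpha : i j / (i <= j)%N} ->
  (forall i, s i + alpha (pi i) <= M)%N ->
  exists S' : {set X}, [/\ sorted_box pi S', S \subset S',
    (#|S'| <= 3 ^ d * #|S|)%N &
    forall s1 alpha1, (alpha1 c.+1 <= alpha c.+1)%N ->
    forall y z, y \in box s1 (fun i => alpha1 (pi i)) -> y \in S ->
      z \in box s1 (fun i => alpha1 (pi i)) ->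
      (forall i, pi i != c.+1 -> z i = y i) -> z \in S'].
Proof.
move=> S /forallP tpi a0 am sM.
pose l := alpha c.+1; pose L := minn (3 * l) M.
(* The maximum equals [L] as soon as some side is labelled [c.+1]; otherwise it keeps [alpha']
   nondecreasing. *)
pose alpha' k := if (k <= c)%N then alpha k else maxn (alpha c) L.
have apos k : (0 < alpha k)%N by have := am 0%N k isT; rewrite a0.
have ac := am _ _ (leqnSn c).
(* The side starts l further left, stopped at 0 by truncated subtraction and moved back if its right
   end would leave the grid. *)
pose s' i := if pi i == c.+1 then minn (s i - l) (M - L) else s i.
have low i : pi i != c.+1 -> s' i = s i /\ alpha' (pi i) = alpha (pi i).
  move=> pc; rewrite /s' (negbTE pc) /alpha'; split => //.
  by have -> : (pi i <= c)%N by have := tpi i; lia.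
have top i : pi i = c.+1 -> [/\ (s i + l <= M)%N, s' i = minn (s i - l) (M - L)
    & alpha' (pi i) = L].
  move=> pc; have sMi : (s i + l <= M)%N by have := sM i; rewrite pc.
  rewrite /s' pc eqxx /alpha' ltnn; split => //.
  by rewrite -/l in ac; rewrite /L; lia.
have s'M i : (s' i <= s i)%N /\ (s i + alpha (pi i) <= s' i + alpha' (pi i) <= M)%N.
  have [pc|pc] := eqVneq (pi i) c.+1.
    by have [h -> ->] := top i pc; rewrite pc -/l; lia.
  by have [-> ->] := low i pc; have := sM i; lia.
exists (box s' (fun i => alpha' (pi i))); split.
- exists alpha', s'; split => //.
    move=> i j ij; rewrite /alpha'; case: ifP => ic; case: ifP => jc //.
    + exact: am.
    + by rewrite (leq_trans (am _ _ ic)) // leq_maxl.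
    + by lia.
  by move=> i; have := s'M i; lia.
- apply/subsetP => y /in_box yS; apply/in_box => i.
  by have := yS i; have := s'M i; lia.
- rewrite !card_box //; last by move=> i; have := s'M i; lia.
  rewrite -[X in (3 ^ X * _)%N]card_ord -prod_nat_const -big_split /=.
  apply: leq_prod => i _.
  have [pc|pc] := eqVneq (pi i) c.+1.
    by have [h _ ->] := top i pc; rewrite pc -/l; lia.
  by have [_ ->] := low i pc; lia.
move=> s1 alpha1 l1 y z /in_box yQ /in_box yS /in_box zQ zy; apply/in_box => i.
have [pc|pc] := eqVneq (pi i) c.+1.
  have [h -> ->] := top i pc; have := yQ i; have := yS i; have := zQ i.
  have := ltn_ord (z i); rewrite pc -/l /L; rewrite -/l in l1; move: h l1; clearbody l; clear;
  move: (s i) (s1 i) (nat_of_ord (y i)) (nat_of_ord (z i)) (alpha1 _); lia.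
by rewrite zy //; have [-> ->] := low i pc.
Qed.

End covering.

(** * Weak type inequality, by induction on the complexity *)

Section weak_type.
Context {R : realType} {d : nat}.

(* One selected box [S], with [S'] its dilation: testing the averages against
   [f u^(1/p)] lets the unweighted maximal inequality absorb the weight. *)
Lemma selected_box M c pi (p lam : R) (f v : {ffun 'I_d -> 'I_M} -> R)
    (S S' E : {set {ffun 'I_d -> 'I_M}}) :
  1 < p -> 0 < lam -> (forall x, 0 <= f x) -> (forall x, 0 <= v x) ->
  side_pattern c pi -> sorted_box pi S -> sorted_box pi S' ->
  S \subset S' -> (#|S'| <= 3 ^ d * #|S|)%N ->
  E \subset S -> (#|S| <= 2 * #|E|)%N -> lam <= avg S f ->
  lam `^ p * \sum_(x in S') v x <=
  (2 * 3 ^ d)%N%:R *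
  \sum_(x in E) strong_max (fun y => f y * grid_maximal c v y `^ p^-1) x `^ p.
Proof.
move=> p1 lam0 f0 v0 tpi bS bS' SS' S'S ES SE lamS.
have p0 : 0 < p by lra.
have pV0 : 0 < p^-1 by rewrite invr_gt0.
set a := avg S' v; pose h y := f y * grid_maximal c v y `^ p^-1; rewrite -/h.
have a0 : 0 <= a by exact: avg_ge0.
have h0 y : 0 <= h y by rewrite mulr_ge0 ?powR_ge0.
have aS x : x \in S -> a <= grid_maximal c v x.
  by move=> xS; apply: le_grid_maximal; [exists pi | apply: (subsetP SS')].
(* On [S] the weight factor of [h] is at least a^(1/p), so [h] has average at least lam a^(1/p)
   there. *)
have key x : x \in E -> lam `^ p * a <= strong_max h x `^ p.
  move=> xE; have xS := subsetP ES _ xE.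
  have -> : lam `^ p * a = (lam * a `^ p^-1) `^ p.
    rewrite powRM ?powR_ge0 ?(ltW lam0) // -powRrM mulVf ?gt_eqF // powRr1 //.
  have lamh : lam * a `^ p^-1 <= strong_max h x.
    apply: le_trans (avg_le_strong_max h0 bS xS).
    apply: (@le_trans _ _ (avg S f * a `^ p^-1)).
      by rewrite ler_wpM2r ?powR_ge0.
    rewrite /avg mulrAC ler_wpM2r ?invr_ge0 // mulr_suml.
    apply: ler_sum => y yS; rewrite ler_wpM2l //.
    by apply: ge0_ler_powR; rewrite ?nnegrE ?grid_maximal_ge0 ?aS // ltW.
  have la0 : 0 <= lam * a `^ p^-1 by rewrite mulr_ge0 ?powR_ge0 // ltW.
  apply: ge0_ler_powR => //; rewrite ?nnegrE //; first exact: ltW.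
  exact: le_trans lamh.
apply: (@le_trans _ _ ((2 * 3 ^ d)%N%:R * \sum_(x in E) (lam `^ p * a))); last first.
  by rewrite ler_wpM2l //; apply: ler_sum => x /key.
rewrite sumr_const -[X in _ <= _ * X]mulr_natl avgE -/a mulrCA [leRHS]mulrA -natrM.
apply: ler_wpM2r; first by rewrite mulr_ge0 ?powR_ge0.
rewrite ler_nat.
apply: leq_trans S'S _.
by rewrite [(2 * _)%N]mulnC -mulnA leq_mul2l SE orbT.
Qed.

(* For [pi = 0] the boxes are points, which is where the induction starts. *)
Lemma weak_type (c : nat) (p : R) : 1 < p -> exists2 K : R, 0 < K &
  forall M (pi : 'I_d -> nat) (f v : {ffun 'I_d -> 'I_M} -> R)
    (U : {set {ffun 'I_d -> 'I_M}}) (lam : R),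
  side_pattern c pi -> (forall x, 0 <= f x) -> (forall x, 0 <= v x) -> 0 < lam ->
  (forall x, x \in U ->
     exists B : {set _}, [/\ sorted_box pi B, x \in B & lam <= avg B f]) ->
  lam `^ p * \sum_(x in U) v x <= K * \sum_x f x `^ p * iter_grid_maximal c v x.
Proof.
move=> p1; have p0 : 0 < p by lra.
elim: c => [|c [K K0 IH]].
  exists 1 => // M pi f v U lam /forallP tpi f0 v0 lam0 HU.
  rewrite mul1r /= mulr_sumr big_mkcond; apply: ler_sum => x _.
  case: ifP => [/HU|_]; last by rewrite mulr_ge0 ?powR_ge0.
  move=> [B [[alpha [s [a0 am sM ->]]] xB]] lamB.
  have pi0 i : pi i = 0%N by have := tpi i; lia.
  have E : box s (fun i => alpha (pi i)) = [set x].
    apply/setP => y; rewrite in_set1; apply/in_box/eqP => [yB|->].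
      apply/ffunP => i; apply/val_inj => /=.
      by have := yB i; have /in_box/(_ i) := xB; rewrite pi0 a0; lia.
    exact/in_box.
  rewrite E /avg big_set1 cards1 divr1 in lamB.
  apply: ler_wpM2r => //; apply: ge0_ler_powR; rewrite ?nnegrE //; exact: ltW.
have [C C0 HC] := strong_max_strong d p1.
exists (2 `^ p * (K * ((2 * 3 ^ d)%N%:R * C))).
  have ? : 0 < 2 `^ p :> R by exact: powR_gt0.
  have ? : 0 < (2 * 3 ^ d)%N%:R :> R by rewrite ltr0n muln_gt0 expn_gt0.
  by apply: mulr_gt0 => //; apply: mulr_gt0 => //; apply: mulr_gt0.
move=> M pi f v U lam tpi f0 v0 lam0 HU.
set u := iter_grid_maximal c v.
have u0 x : 0 <= u x by exact: iter_grid_maximal_ge0.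
pose X := {ffun 'I_d -> 'I_M}.
have /choice[as_ Has] : forall x : X, exists z : (nat -> nat) * ('I_d -> nat), x \in U ->
   let B := box z.2 (fun i => z.1 (pi i)) in
   [/\ z.1 0 = 1%N, {homo z.1 : i j / (i <= j)%N},
       (forall i, z.2 i + z.1 (pi i) <= M)%N, x \in B & lam <= avg B f].
  move=> x; case: (boolP (x \in U)) => [/HU|_]; last by exists (fun=> 0%N, fun=> 0%N).
  by move=> [_ [[alpha [s [a0 am sM ->]]] xB lamB]]; exists (alpha, s).
pose Q (x : X) : {set X} := box (as_ x).2 (fun i => (as_ x).1 (pi i)).
(* The label that orders the selection is the longest sidelength. *)
have [J [E [JU EJ dE cov]]] := greedy_selection Q (fun x => (as_ x).1 c.+1) U.
have /choice[St HSt] : forall x : X, exists S' : {set X}, x \in U ->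
    [/\ sorted_box pi S', Q x \subset S', (#|S'| <= 3 ^ d * #|Q x|)%N &
    forall s1 alpha1, (alpha1 c.+1 <= (as_ x).1 c.+1)%N ->
    forall y z, y \in box s1 (fun i => alpha1 (pi i)) -> y \in Q x ->
      z \in box s1 (fun i => alpha1 (pi i)) ->
      (forall i, pi i != c.+1 -> z i = y i) -> z \in S'].
  move=> x; case: (boolP (x \in U)) => [xU|_]; last by exists set0.
  have [a0 am sM _ _] := Has _ xU.
  by have [S' HS'] := star_box tpi a0 am sM; exists S'.
pose G := \bigcup_(j in J) St j.
pose g (x : X) : R := (x \in G)%:R.
have tpi' : side_pattern c (fun i => minn (pi i) c).
  apply/forallP => i; have /forallP/(_ i) := tpi.
  by rewrite leq_min geq_minr; case: ltnP => //=; lia.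
have cyl x y z : x \in U ->
    y \in Q x :&: \bigcup_(j in J | ((as_ x).1 c.+1 <= (as_ j).1 c.+1)%N) Q j ->
    z \in Q x -> (forall i, pi i != c.+1 -> z i = y i) -> z \in G.
  move=> xU /setIP[yQ /bigcupP[j /andP[jJ xj] yj]] zQ zy.
  have [_ _ _ H] := HSt _ (subsetP JU _ jJ).
  by apply/bigcupP; exists j => //; exact: (H (as_ x).2 (as_ x).1 xj y z yQ yj zQ zy).
have half : 0 < 2^-1 :> R by rewrite invr_gt0.
have := IH M (fun i => minn (pi i) c) g v U 2^-1 tpi' _ v0 half.
move=> /(_ (fun x => ler0n _ _)) IH1.
(* The induction hypothesis is applied to the indicator of [G] at level 1/2: by [subbox_half], each
   point of [U] lies in a box with one sidelength fewer, half filled by [G]. *)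
have {}IH1 : 2^-1 `^ p * \sum_(x in U) v x <= K * \sum_x g x `^ p * u x.
  apply: IH1 => x xU; have [a0 am sM xQ lamQ] := Has _ xU.
  have [Q' [bQ' xQ' Q'G]] := @subbox_half d M c pi (as_ x).2 (as_ x).1 x _ G
    tpi a0 am sM xQ (cov x xU) (fun y z => cyl x y z xU).
  exists Q'; split => //.
    have Q'0 : 0 < #|Q'|%:R :> R by rewrite ltr0n; apply/card_gt0P; exists x.
    rewrite /avg ler_pdivlMr //.
    have -> : \sum_(y in Q') g y = #|Q' :&: G|%:R.
      rewrite -sum1_card natr_sum big_mkcond [RHS]big_mkcond /=.
      by apply: eq_bigr => y _; rewrite inE /g; case: (y \in Q'); case: (y \in G).
    by rewrite mulrC ler_pdivrMr // -natrM ler_nat mulnC.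
have gG : \sum_x g x `^ p * u x <= \sum_(j in J) \sum_(x in St j) u x.
  rewrite [leRHS](exchange_big_dep predT) //=; apply: ler_sum => x _.
  rewrite /g; case: (boolP (x \in G)) => [/bigcupP[j jJ xj]|_].
    rewrite powR1 mul1r (bigD1 j) ?jJ //= lerDl sumr_ge0 //.
  by rewrite powR0 ?gt_eqF // mul0r sumr_ge0.
(* [selected_box] is summed over [J]; as the [E j] are disjoint, one application of the strong
   maximal inequality to [h] handles the whole sum. *)
have Est : lam `^ p * \sum_(j in J) \sum_(x in St j) u x <=
    (2 * 3 ^ d)%N%:R * (C * \sum_x f x `^ p * grid_maximal c.+1 u x).
  pose h (y : X) := f y * grid_maximal c.+1 u y `^ p^-1.
  have h0 y : 0 <= h y by rewrite mulr_ge0 ?powR_ge0.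
  have -> : \sum_x f x `^ p * grid_maximal c.+1 u x = \sum_x h x `^ p.
    apply: eq_bigr => x _; rewrite /h powRM ?powR_ge0 // -powRrM mulVf ?gt_eqF //.
    by rewrite powRr1 // grid_maximal_ge0.
  apply: (@le_trans _ _ ((2 * 3 ^ d)%N%:R * \sum_(j in J) \sum_(x in E j) strong_max h x `^ p)).
    rewrite !mulr_sumr; apply: ler_sum => j jJ.
    have jU := subsetP JU _ jJ; have [a0 am sM xQ lamQ] := Has _ jU.
    have [bSt QSt SQ _] := HSt _ jU; have [EQ QE] := EJ _ jJ.
    apply: (selected_box p1 lam0 f0 u0 tpi _ bSt QSt SQ EQ QE lamQ).
    by exists (as_ j).1, (as_ j).2.
  rewrite ler_wpM2l //; apply: le_trans (HC _ _ h0).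
  by apply: sum_disjoint_le dE => x; exact: powR_ge0.
have h2 : 2 `^ p * 2^-1 `^ p = 1 :> R.
  by rewrite -powRM ?invr_ge0 // divff ?powR1 // pnatr_eq0.
apply: (@le_trans _ _ (2 `^ p * (lam `^ p * (2^-1 `^ p * \sum_(x in U) v x)))).
  by rewrite [lam `^ p * (_ * _)]mulrCA [leRHS]mulrA h2 mul1r.
rewrite -mulrA; apply: ler_wpM2l; first exact: powR_ge0.
apply: (le_trans (ler_wpM2l (powR_ge0 _ _) IH1)); rewrite -mulrA.
rewrite mulrCA ler_wpM2l ?(ltW K0) //.
by rewrite -mulrA; apply: le_trans Est; apply: ler_wpM2l; rewrite ?powR_ge0.
Qed.

End weak_type.

(** * Strong type inequality on the grid *)

Section discrete_inequality.
Context {R : realType} {d : nat}.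

Lemma box_of_complexity_point M c (x : {ffun 'I_d -> 'I_M}) :
  exists2 B, box_of_complexity c B & x \in B.
Proof.
exists (box (fun i => x i : nat) (fun=> 1%N)); last by apply/in_box => i; lia.
exists (fun=> (0 < c)%N : nat); first by apply/forallP => i; lia.
by exists (fun=> 1%N), (fun i => x i : nat); split => // i; have := ltn_ord (x i); lia.
Qed.

(** Discarding the values of [f] below lam / 2 lowers an average by at most lam / 2, which confines
    the right-hand side to a level set of 2 f, as interpolation requires. The level set on the left
    is split according to the side pattern of a maximizing box; [N] counts the patterns. *)
Lemma discrete_weak (c : nat) (p : R) : 1 < p -> exists2 K : R, 0 < K &
  forall M (f v : {ffun 'I_d -> 'I_M} -> R) (lam : R),
  (forall x, 0 <= f x) -> (forall x, 0 <= v x) -> 0 < lam ->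
  lam `^ p * \sum_(x | lam <= grid_maximal c f x) v x <=
  \sum_(x | lam <= 2 * f x) K * (f x `^ p * iter_grid_maximal c v x).
Proof.
move=> p1; have [K K0 HK] := @weak_type R d c p p1.
pose N := #|{ffun 'I_d -> 'I_c.+1}|.
have N0 : 0 < N%:R :> R by rewrite ltr0n; apply/card_gt0P; exists [ffun=> ord0].
exists (2 `^ p * (N%:R * K)).
  by apply: mulr_gt0; [exact: powR_gt0 | exact: mulr_gt0].
move=> M f v lam f0 v0 lam0.
pose X := {ffun 'I_d -> 'I_M}.
pose f1 x := if lam <= 2 * f x then f x else 0.
have f10 x : 0 <= f1 x by rewrite /f1; case: ifP.
have p0 : p != 0 by rewrite gt_eqF //; lra.
have -> : \sum_(x | lam <= 2 * f x) (2 `^ p * (N%:R * K)) * (f x `^ p * iter_grid_maximal c v x) =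
    2 `^ p * (N%:R * (K * \sum_x f1 x `^ p * iter_grid_maximal c v x)).
  rewrite -mulr_sumr -!mulrA; congr (_ * (_ * (_ * _))).
  rewrite big_mkcond; apply: eq_bigr => x _; rewrite /f1; case: ifP => // _.
  by rewrite powR0 // mul0r.
have /choice[pi_ Hpi] : forall x : X, exists pi : {ffun 'I_d -> 'I_c.+1},
   exists B : {set X}, [/\ side_pattern c (fun i => pi i : nat),
     sorted_box (fun i => pi i : nat) B, x \in B & grid_maximal c f x = avg B f].
  move=> x; have [B [[pi tpi bB] xB mB]] := grid_maximal_attained (box_of_complexity_point c x) f0.
  have pic i : (pi i < c.+1)%N by have /forallP/(_ i)/andP[_] := tpi.
  exists [ffun i => inord (pi i)], B.
  have -> : (fun i => [ffun i => inord (pi i) : 'I_c.+1] i : nat) = pi.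
    by apply: funext => i; rewrite ffunE inordK.
  by [].
have lam2 : 0 < lam / 2 by lra.
have H (pi : {ffun 'I_d -> 'I_c.+1}) :
  (lam / 2) `^ p * \sum_(x in [set x | (lam <= grid_maximal c f x) && (pi_ x == pi)]) v x <=
  K * \sum_x f1 x `^ p * iter_grid_maximal c v x.
  set U := [set x | _].
  have [->|[x0]] := set_0Vmem U.
    rewrite big_set0 mulr0 mulr_ge0 ?(ltW K0) // sumr_ge0 // => x _.
    by rewrite mulr_ge0 ?powR_ge0 ?iter_grid_maximal_ge0.
  rewrite inE => /andP[_ /eqP x0pi].
  have [B0 [tpi _ _ _]] := Hpi x0; rewrite x0pi in tpi.
  apply: (HK _ _ _ _ _ _ tpi) => // x; rewrite inE => /andP[lx /eqP xpi].
  have [B [_ bB xB mB]] := Hpi x; rewrite xpi in bB; exists B; split => //.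
  have B0' : 0 < #|B|%:R :> R by rewrite ltr0n; apply/card_gt0P; exists x.
  move: lx; rewrite mB /avg !ler_pdivlMr // => lx.
  suff : \sum_(y in B) f y <= \sum_(y in B) f1 y + lam / 2 * #|B|%:R by lra.
  rewrite mulr_natr -sumr_const -big_split /=; apply: ler_sum => y _.
  by rewrite /f1; case: (leP lam (2 * f y)) => h; lra.
have -> : lam `^ p = 2 `^ p * (lam / 2) `^ p.
  by rewrite -powRM //; [congr (_ `^ _); lra | exact: ltW].
rewrite -mulrA ler_wpM2l ?powR_ge0 //.
rewrite (partition_big pi_ predT) //= mulr_sumr.
have -> : N%:R * (K * \sum_x f1 x `^ p * iter_grid_maximal c v x) =
   \sum_(pi : {ffun 'I_d -> 'I_c.+1}) K * \sum_x f1 x `^ p * iter_grid_maximal c v x.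
  by rewrite sumr_const mulr_natl.
apply: ler_sum => pi _; apply: le_trans (H pi).
rewrite le_eqVlt; apply/orP; left; apply/eqP; congr (_ * _).
by apply: eq_bigl => x; rewrite inE.
Qed.

(** Interpolation from an exponent p0 strictly between 1 and p. The factor f^p0 is part of the
    weight on the right, so that (2 f)^(p - p0) completes it to f^p. *)
Theorem discrete_strong (c : nat) (p : R) : 1 < p -> exists2 K : R, 0 < K &
  forall M (f v : {ffun 'I_d -> 'I_M} -> R),
  (forall x, 0 <= f x) -> (forall x, 0 <= v x) ->
  \sum_x grid_maximal c f x `^ p * v x <= K * \sum_x f x `^ p * iter_grid_maximal c v x.
Proof.
move=> p1; pose p0 := (1 + p) / 2.
have p01 : 1 < p0 by rewrite /p0; lra.
have p0p : 0 < p0 < p by rewrite /p0; apply/andP; split; lra.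
have [K K0 HK] := @discrete_weak c p0 p01.
have r0 : 0 < p - p0 by rewrite subr_gt0; case/andP: p0p.
have pp : 0 < p by lra.
exists (p * (2 `^ (p - p0) * K) / (p - p0)).
  by apply: divr_gt0 => //; apply: mulr_gt0 => //; apply: mulr_gt0 => //; exact: powR_gt0.
move=> M f v f0 v0.
have u0 x : 0 <= K * (f x `^ p0 * iter_grid_maximal c v x).
  by apply: mulr_ge0; [exact: ltW | rewrite mulr_ge0 ?powR_ge0 ?iter_grid_maximal_ge0].
have f20 x : 0 <= 2 * f x by rewrite mulr_ge0.
have := marcinkiewicz p0p (fun x => grid_maximal_ge0 c f x) f20 v0 u0
  (fun l l0 => HK M f v l f0 v0 l0).
rewrite mulrC -ler_pdivlMr //; move/le_trans; apply.
rewrite [leRHS]mulrAC ler_pM2r ?invr_gt0 // -!mulrA ler_pM2l // !mulr_sumr.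
rewrite le_eqVlt; apply/orP; left; apply/eqP; apply: eq_bigr => x _.
rewrite powRM // -!mulrA; congr (_ * _).
rewrite mulrCA; congr (_ * _); rewrite mulrA; congr (_ * _).
by rewrite -powRD; [congr (_ `^ _); lra | rewrite subrK gt_eqF].
Qed.

End discrete_inequality.

(** * From the grid to Lebesgue measure *)

From mathcomp Require Import all_classical all_reals all_analysis.
From mathcomp Require Import measurable_realfun.
Import numFieldNormedType.Exports.
Local Open Scope classical_set_scope.
Local Open Scope ereal_scope.

(** * Measure of rectangles *)

Section rectangle_measure.
Context {R : realType}.
Local Notation itv_of a b l r i :=
  (Interval (BSide (l i) (a i)) (BSide (~~ r i) (b i))).

(** The same set as [rectangle], viewed in the Borel sigma-algebra, where product measures compute
    its volume. *)
Definition tuple_rectangle d (a b : 'I_d -> R) (l r : 'I_d -> bool) :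
    set (d.-tuple (measurableTypeR R)) :=
  [set x | forall i, tnth x i \in itv_of a b l r i].

Lemma measurable_tuple_rectangle d (a b : 'I_d -> R) l r :
  measurable (tuple_rectangle a b l r).
Proof.
have -> : tuple_rectangle a b l r =
    \big[setI/setT]_(i <- index_enum 'I_d)
      ((fun x => tnth x i) @^-1` [set` itv_of a b l r i]).
  apply/seteqP; split => x /=.
    by move=> xi; rewrite -bigcap_seq => i _ /=; exact: xi.
  by rewrite -bigcap_seq => xi i; apply: xi => /=; exact: mem_index_enum.
apply: bigsetI_measurable => i _.
rewrite -[X in measurable X]setTI; apply: measurable_tnth => //.
Qed.

Lemma borel_lebesgue_rectangle d (a b : 'I_d -> R) l r :
  (forall i, (a i < b i)%R) ->
  borel_lebesgue R d (tuple_rectangle a b l r) = (\prod_i (b i - a i))%R%:E.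
Proof.
elim: d a b l r => [|d IH] a b l r ab.
  rewrite big_ord0 /= diracE mem_set //= => -[] //.
rewrite /= /cons_measure /pushforward /=.
have -> : cons_pair (d:=d) @^-1` tuple_rectangle a b l r =
   [set` itv_of a b l r ord0] `*`
   tuple_rectangle (fun i => a (lift ord0 i)) (fun i => b (lift ord0 i))
     (fun i => l (lift ord0 i)) (fun i => r (lift ord0 i)).
  apply/seteqP; split => -[y z] /=.
    move=> xi; split; first by have := xi ord0.
    by move=> i; have := xi (lift ord0 i); rewrite /cons_pair /= tnthS.
  move=> [y0 zi] i; case: (unliftP ord0 i) => [j ->|->] //.
  by rewrite /cons_pair /= tnthS; exact: zi.
rewrite product_measure2E.
- rewrite IH //.
  have := lebesgue_measure_itv (itv_of a b l r ord0).
  rewrite /= lte_fin ab => ->.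
  by rewrite -EFinB -EFinM big_ord_recl.
- exact: measurable_itv.
- exact: measurable_tuple_rectangle.
Qed.

Lemma measurable_rectangle d (a b : 'I_d -> R) l r :
  measurable (rectangle a b l r : set (Rn R d)).
Proof.
apply: sub_caratheodory; apply: sub_sigma_algebra.
exact: measurable_tuple_rectangle.
Qed.

Lemma lebesgue_rectangle d (a b : 'I_d -> R) l r :
  (forall i, (a i < b i)%R) ->
  lebesgue R d (rectangle a b l r) = (\prod_i (b i - a i))%R%:E.
Proof.
move=> ab; rewrite -(borel_lebesgue_rectangle l r ab).
by apply: measurable_mu_extE; exact: measurable_tuple_rectangle.
Qed.

End rectangle_measure.

(** * The dyadic grid and functions constant on its cells *)

Section grid.
Context {R : realType} {d : nat} (N : nat).

(* The number of points in each direction of the grid of mesh [2^-N] on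
   [-2^N, 2^N)^d; [pos] rescales a coordinate so that the grid becomes that of
   the integers between [0] and [gsize]. *)
Definition gsize : nat := (2 * 2 ^ N * 2 ^ N)%N.
Local Notation X := {ffun 'I_d -> 'I_gsize}.
Local Notation mu := (lebesgue R d).

Definition pos (x : Rn R d) (i : 'I_d) : R := ((coordRn x i + 2 ^+ N) * 2 ^+ N)%R.

(** Closed on the left and open on the right, so that distinct cells are disjoint. *)
Definition gbox (s n : 'I_d -> nat) : set (Rn R d) :=
  rectangle (fun i => (s i)%:R / 2 ^+ N - 2 ^+ N)%R
    (fun i => (s i + n i)%:R / 2 ^+ N - 2 ^+ N)%R (fun=> true) (fun=> false).

Let p2 : (0 < 2 ^+ N :> R)%R. Proof. exact: exprn_gt0. Qed.

Lemma in_gbox s n x :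
  gbox s n x <-> forall i, ((s i)%:R <= pos x i < (s i + n i)%:R)%R.
Proof.
rewrite /gbox /rectangle /=; split => H i; have := H i.
  by rewrite in_itv /= lerBlDr ltrBrDr ler_pdivrMr // ltr_pdivlMr.
by rewrite in_itv /= lerBlDr ltrBrDr ler_pdivrMr // ltr_pdivlMr.
Qed.

Lemma measurable_gbox s n : measurable (gbox s n).
Proof. exact: measurable_rectangle. Qed.

Lemma lebesgue_gbox s n : (forall i, 0 < n i)%N ->
  mu (gbox s n) = ((\prod_i n i)%N%:R / (2 ^+ N) ^+ d)%R%:E.
Proof.
move=> n0; rewrite lebesgue_rectangle; last first.
  move=> i; rewrite ltrD2r ltr_pM2r ?invr_gt0 // ltr_nat.
  by rewrite -[X in (X < _)%N]addn0 ltn_add2l.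
congr EFin; rewrite natr_prod.
have -> : ((2 ^+ N) ^+ d)^-1%R = (\prod_(i < d) (2 ^+ N)^-1)%R :> R.
  by rewrite prodr_const card_ord exprVn.
rewrite -big_split /=.
apply: eq_bigr => i _; rewrite natrD; ring.
Qed.

Definition cell (k : X) : set (Rn R d) := gbox (fun i => k i : nat) (fun=> 1%N).

Lemma cell_uniq k k' x : cell k x -> cell k' x -> k = k'.
Proof.
move=> /in_gbox kx /in_gbox k'x; apply/ffunP => i; apply/val_inj => /=.
have /andP[a b] := kx i; have /andP[a' b'] := k'x i.
have := le_lt_trans a b'; have := le_lt_trans a' b.
by rewrite !ltr_nat; lia.
Qed.

Lemma gbox_cell s n x : (forall i, s i + n i <= gsize)%N ->
  gbox s n x <-> exists2 k, k \in box s n & cell k x.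
Proof.
move=> sM; split=> [/in_gbox sx|[k /in_box ks /in_gbox kx]]; last first.
  apply/in_gbox => i; have /andP[a b] := kx i; have /andP[c e] := ks i.
  apply/andP; split; first by apply: le_trans a; rewrite ler_nat.
  by apply: (lt_le_trans b); rewrite ler_nat addn1.
(* The cell of [x] is read off the integer parts of its rescaled coordinates. *)
have pk i : (Num.truncn (pos x i) < gsize)%N.
  have /andP[a b] := sx i; apply: leq_trans (sM i).
  by rewrite truncn_lt_nat // (le_trans _ a).
exists [ffun i => Ordinal (pk i)].
  apply/in_box => i; have /andP[a b] := sx i; rewrite ffunE /=.
  have p0 : (0 <= pos x i)%R by apply: le_trans a.
  by rewrite truncn_lt_nat // b truncn_ge_nat // a.
apply/in_gbox => i; have /andP[a b] := sx i; rewrite ffunE /= addn1.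
have p0 : (0 <= pos x i)%R by apply: le_trans a.
exact: truncn_itv.
Qed.

Definition step (c : X -> R) (x : Rn R d) : R := (\sum_k c k * \1_(cell k) x)%R.

Lemma step_cell c k x : cell k x -> step c x = c k.
Proof.
move=> kx; rewrite /step (bigD1 k) //= indicE mem_set // mulr1 big1 ?addr0 //.
move=> j jk; rewrite indicE memNset ?mulr0 // => jx.
by move: jk; rewrite (cell_uniq jx kx) eqxx.
Qed.

Lemma step_out c x : (forall k, ~ cell k x) -> step c x = 0%R.
Proof. by move=> H; rewrite /step big1 // => k _; rewrite indicE memNset ?mulr0. Qed.

Lemma step_ge0 c x : (forall k, 0 <= c k)%R -> (0 <= step c x)%R.
Proof. by move=> c0; apply: sumr_ge0 => k _; rewrite mulr_ge0. Qed.

Lemma measurable_step c : measurable_fun setT (step c).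
Proof.
apply: measurable_sum => k; apply: measurable_funM; first exact: measurable_cst.
by apply: measurable_indic; exact: measurable_gbox.
Qed.

Lemma integral_step (c : X -> R) (g : Rn R d -> \bar R) :
  (forall k, 0 <= c k)%R -> (forall x, 0 <= g x) -> measurable_fun setT g ->
  \int[mu]_x ((step c x)%:E * g x) = \sum_k (c k)%:E * \int[mu]_(x in cell k) g x.
Proof.
move=> c0 g0 mg.
have E x : (step c x)%:E * g x = \sum_k (c k)%:E * ((\1_(cell k) x)%:E * g x).
  rewrite /step -sumEFin ge0_sume_distrl; last first.
    by move=> k _; rewrite lee_fin mulr_ge0.
  by apply: eq_bigr => k _; rewrite EFinM muleA.
under eq_integral do rewrite E.
have mI k : measurable_fun setT (fun x => (\1_(cell k) x)%:E * g x).
  apply: emeasurable_funM; last exact: mg.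
  by apply/measurable_EFinP; apply: measurable_indic; exact: measurable_gbox.
have I0 k x : 0 <= (\1_(cell k) x)%:E * g x by rewrite mule_ge0 // lee_fin.
have mcI k : measurable_fun setT (fun x => (c k)%:E * ((\1_(cell k) x)%:E * g x)).
  exact: measurable_funeM.
have cI0 k x : setT x -> 0 <= (c k)%:E * ((\1_(cell k) x)%:E * g x).
  by move=> _; rewrite mule_ge0 // lee_fin.
rewrite (ge0_integral_sum mu measurableT mcI cI0).
apply: eq_bigr => k _; rewrite ge0_integralZl_EFin //; congr (_ * _).
rewrite [RHS]integral_mkcond; apply: eq_integral => x _.
by rewrite epatch_indic muleC.
Qed.

Lemma integral_gbox s n (g : Rn R d -> \bar R) : (forall i, s i + n i <= gsize)%N ->
  (forall x, 0 <= g x) -> measurable_fun setT g ->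
  \int[mu]_(x in gbox s n) g x = \sum_(k in box s n) \int[mu]_(x in cell k) g x.
Proof.
move=> sM g0 mg.
transitivity (\int[mu]_x ((step (fun k => (k \in box s n)%:R) x)%:E * g x)).
  rewrite integral_mkcond; apply: eq_integral => x _.
  rewrite epatch_indic muleC; congr (_%:E * _); rewrite indicE.
  have [xs|xs] := pselect (gbox s n x).
    rewrite mem_set //; have /(gbox_cell _ sM)[k ks kx] := xs.
    by rewrite (step_cell _ kx) ks.
  rewrite memNset //.
  have [[k kx]|nk] := pselect (exists k, cell k x).
    rewrite (step_cell _ kx); case: (boolP (k \in box s n)) => // ks.
    by exfalso; apply: xs; apply/(gbox_cell _ sM); exists k.
  by rewrite step_out // => k kx; apply: nk; exists k.
rewrite integral_step // [RHS]big_mkcond; apply: eq_bigr => k _.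
by case: (k \in box s n); rewrite ?mul1e ?mul0e.
Qed.

End grid.

(* Used with [maximal], whose measurability is thus not needed: the integral
   is a supremum over the simple functions below the integrand. *)
Lemma le_integral_nonmeasurable d (T : measurableType d) (R : realType)
    (mu : {measure set T -> \bar R}) (D : set T) (f g : T -> \bar R) :
  (forall x, D x -> 0 <= f x <= g x) ->
  \int[mu]_(x in D) f x <= \int[mu]_(x in D) g x.
Proof.
move=> fg; have f0 x : D x -> 0 <= f x by case/fg/andP.
have g0 x : D x -> 0 <= g x by move=> /fg/andP[a b]; exact: le_trans a b.
rewrite !ge0_integralE //; apply: le_ereal_sup => _ [h hf <-].
exists h => // x; apply: le_trans (hf x) _.
by rewrite /patch; case: ifPn => // /set_mem /fg /andP[].
Qed.

(** * Grid maximal functions below continuous ones *)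

Section transfer.
Context {R : realType} {d : nat}.
Local Notation mu := (lebesgue R d).
Local Notation X N := {ffun 'I_d -> 'I_(gsize N)}.

(** The unit cube competes in the supremum, with a nonnegative term even at points outside it. *)
Lemma maximal_ge0 c (g : Rn R d -> \bar R) x : (0 < c)%N -> 0 <= maximal c g x.
Proof.
move=> c0; pose Q := rectangle (R := R) (d := d) (fun=> 0%R) (fun=> 1%R) xpredT xpredT.
apply: (@le_trans _ _ ((\1_Q x)%:E * ((mu Q)^-1 * \int[mu]_(y in Q) `|g y|))).
  rewrite mule_ge0 ?lee_fin //; apply: mule_ge0; last exact: integral_ge0.
  by rewrite inve_ge0.
apply: ereal_sup_ubound; exists Q => //.
exists (fun=> 0%R), (fun=> 1%R), xpredT, xpredT; split => //.
exists (fun=> 1%R); split => // i; exists (Ordinal c0).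
by rewrite subr0.
Qed.

Lemma gbox_rectangles N c (pi : 'I_d -> nat) (alpha : nat -> nat) (s : 'I_d -> nat) :
  side_pattern c.+1 pi -> (forall k, 0 < alpha k)%N ->
  rectangles c.+1 (gbox N s (fun i => alpha (pi i)) : set (Rn R d)).
Proof.
move=> /forallP tpi a0.
have p2 : (0 < 2 ^+ N :> R)%R by exact: exprn_gt0.
do 4 eexists; split; last reflexivity.
  by move=> i; rewrite ltrD2r ltr_pM2r ?invr_gt0 // ltr_nat -[ltnLHS]addn0 ltn_add2l.
(* Labels start at 1 and ordinals at 0, hence the shift. *)
exists (fun k : 'I_c.+1 => (alpha k.+1)%:R / 2 ^+ N)%R; split.
  by move=> k; rewrite divr_gt0 // ltr0n.
move=> i; have /andP[a b] := tpi i.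
have ic : ((pi i).-1 < c.+1)%N by lia.
exists (Ordinal ic) => /=; rewrite prednK //; rewrite natrD; ring.
Qed.

(** A box of the grid is a rectangle of the same complexity. Its integral is split over cells for
    the measurable minorant [g'], then compared with that of [g]. *)
Lemma grid_maximal_le_maximal N c (v : X N -> R) (g g' : Rn R d -> \bar R) k y :
  (forall k, 0 <= v k)%R -> measurable_fun setT g' ->
  (forall x, 0 <= g' x <= g x) ->
  (forall k, (v k / (2 ^+ N) ^+ d)%:E <= \int[mu]_(x in cell k) g' x) ->
  cell k y -> (grid_maximal c.+1 v k)%:E <= maximal c.+1 g y.
Proof.
move=> v0 mg' gg' vg ky.
have p2 : (0 < (2 ^+ N) ^+ d :> R)%R by rewrite !exprn_gt0.
have g'0 x : 0 <= g' x by case/andP: (gg' x).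
have Bk : exists2 B : {set X N}, box_of_complexity c.+1 B & k \in B.
  exists (box (fun i => k i : nat) (fun=> 1%N)); last by apply/in_box => i; lia.
  exists (fun=> 1%N); first by apply/forallP => i.
  by exists (fun=> 1%N), (fun i => k i : nat); split => // i; have := ltn_ord (k i); lia.
have [B [[pi tpi [alpha [s [a0 am sM ->]]]] kB ->]] := grid_maximal_attained Bk v0.
set n := fun i => alpha (pi i).
have apos j : (0 < alpha j)%N by have := am 0%N j isT; rewrite a0.
have Qy : gbox N s n y by apply/(gbox_cell _ sM); exists k.
apply: (@le_trans _ _ ((\1_(gbox N s n) y)%:E *
   ((mu (gbox N s n))^-1 * \int[mu]_(z in gbox N s n) `|g z|))); last first.
  by apply: ereal_sup_ubound; exists (gbox N s n) => //; exact: gbox_rectangles.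
have cb : (\prod_i n i)%N = #|box s n : {set X N}| by rewrite card_box.
rewrite indicE mem_set // mul1e lebesgue_gbox; last by move=> i; exact: apos.
rewrite cb; set b := #|_|; have b0 : (0 < b%:R :> R)%R.
  by rewrite ltr0n; apply/card_gt0P; exists k.
rewrite inver gt_eqF ?divr_gt0 // invf_div.
apply: (@le_trans _ _ (((2 ^+ N) ^+ d / b%:R)%:E *
   \sum_(k in box s n) (v k / (2 ^+ N) ^+ d)%:E)).
  rewrite sumEFin -EFinM lee_fin -mulr_suml avgE -/b.
  rewrite le_eqVlt; apply/orP; left; apply/eqP; field.
  by rewrite (gt_eqF p2) (gt_eqF b0).
apply: lee_wpmul2l; first by rewrite lee_fin divr_ge0 // ltW.
apply: (@le_trans _ _ (\int[mu]_(z in gbox N s n) g' z)).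
  rewrite integral_gbox //; apply: lee_sum => j _; exact: vg.
apply: le_integral_nonmeasurable => z _; rewrite g'0 /=.
by case/andP: (gg' z) => _ /le_trans; apply; exact: lee_abs.
Qed.

Lemma iter_grid_maximal_le_iter_maximal N (v : X N -> R) (w : Rn R d -> R) c :
  (forall x, 0 <= w x)%R -> measurable_fun setT w -> (forall k, 0 <= v k)%R ->
  (forall k, (v k / (2 ^+ N) ^+ d)%:E = \int[mu]_(x in cell k) (w x)%:E) ->
  forall k y, cell k y ->
    (iter_grid_maximal c.+1 v k)%:E <= iter_maximal c.+1 (EFin \o w) y.
Proof.
move=> w0 mw v0 vw.
(* The induction carries a measurable minorant of the iterated maximal function whose cell averages
   dominate the grid iterate. *)
suff H : exists2 g', measurable_fun setT g' &
    (forall x, 0 <= g' x <= iter_maximal c (EFin \o w) x) /\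
    (forall k, (iter_grid_maximal c v k / (2 ^+ N) ^+ d)%:E <= \int[mu]_(x in cell k) g' x).
  move=> k y; have [g' mg' [g'w vg']] := H.
  move=> ky; apply: (@grid_maximal_le_maximal N c
    (iter_grid_maximal c v) _ g' k y _ mg' g'w vg' ky) => j.
  exact: iter_grid_maximal_ge0.
elim: c => [|c [g' mg' [g'w vg']]].
  exists (EFin \o w); first exact/measurable_EFinP.
  split => [x|k]; first by rewrite lexx andbT lee_fin.
  by rewrite vw.
have u0 j : (0 <= iter_grid_maximal c.+1 v j)%R by exact: iter_grid_maximal_ge0.
(* The next minorant is the grid iterate itself, spread over the cells and 0 outside the grid. *)
exists (EFin \o step (iter_grid_maximal c.+1 v)).
  by apply/measurable_EFinP; exact: measurable_step.
split => [x|k].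
  rewrite /= lee_fin step_ge0 //=.
  have [[k kx]|nk] := pselect (exists k : X N, cell k x).
    rewrite (step_cell _ kx); apply: (@grid_maximal_le_maximal N c
    (iter_grid_maximal c v) _ g' k x _ mg' g'w vg' kx) => j.
    exact: iter_grid_maximal_ge0.
  rewrite step_out; last by move=> k kx; apply: nk; exists k.
  exact: maximal_ge0.
rewrite (eq_integral (cst (iter_grid_maximal c.+1 v k)%:E)); last first.
  by move=> x /set_mem kx; rewrite /= (step_cell _ kx).
rewrite integral_cst; last exact: measurable_gbox.
by rewrite lebesgue_gbox // -EFinM big1 // mul1r.
Qed.

End transfer.

(** * Approximation of rectangles by grid boxes *)

Section approximation.
Context {R : realType} {d : nat}.
Local Notation mu := (lebesgue R d).
Local Notation X N := {ffun 'I_d -> 'I_(gsize N)}.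

(** Rescaled, an interval of length L is covered by floor(L) + 2 cells. The bound on 2^N keeps the
    box inside the grid and makes L at least 2, so that each side is at most doubled. *)
Lemma grid_box N c (a b : 'I_d -> R) (l r : 'I_d -> bool) (alpha : 'I_c.+1 -> R) :
  (forall i, exists k, (b i - a i)%R = alpha k) ->
  (forall i, a i < b i)%R ->
  (forall i, `|a i| + `|b i| + 2 + 2 / (b i - a i) <= 2 ^+ N)%R ->
  exists (pi : 'I_d -> nat) (beta : nat -> nat) (s : 'I_d -> nat),
    [/\ side_pattern c.+1 pi,
        [/\ beta 0%N = 1%N, {homo beta : i j / (i <= j)%N} &
           forall i, (s i + beta (pi i) <= gsize N)%N],
        rectangle a b l r `<=` gbox N s (fun i => beta (pi i)) &
        ((\prod_i beta (pi i))%N%:R / (2 ^+ N) ^+ d <= 2 ^+ d * \prod_i (b i - a i))%R].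
Proof.
move=> side ab HN.
set P := (2 ^+ N)%R in HN *.
have P0 : (0 < P)%R by exact: exprn_gt0.
pose t := sort <=%R (codom alpha).
have tsize : size t = c.+1 by rewrite size_sort size_codom card_ord.
have tsorted : sorted <=%R t by apply: sort_sorted; exact: le_total.
(* Rounding depends on the sidelength only, so the complexity does not grow. Capping the index at
   [c] keeps [beta] nondecreasing past the end of [t]. *)
pose beta j := if j is j'.+1 then (Num.truncn (nth 0%R t (minn j' c) * P) + 2)%N else 1%N.
pose pi i := (index (b i - a i)%R t).+1.
have tin i : (b i - a i)%R \in t.
  by rewrite mem_sort; have [k ->] := side i; exact: codom_f.
have pic i : (index (b i - a i)%R t <= c)%N by rewrite -ltnS -tsize index_mem.
have betapi i : beta (pi i) = (Num.truncn ((b i - a i) * P) + 2)%N.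
  by rewrite /beta /pi (minn_idPl (pic i)) nth_index.
pose s i := Num.truncn ((a i + P) * P).
have main i : [/\ (0 <= (a i + P) * P)%R, (0 <= (b i - a i) * P)%R,
    (b i * P + 2 <= P * P)%R & (2 <= (b i - a i) * P)%R].
  have D0 : (0 < b i - a i)%R by rewrite subr_gt0.
  have q0 : (0 < 2 / (b i - a i))%R by rewrite divr_gt0.
  have := HN i; have := ler_norm (b i); have := ler_norm (- a i); rewrite normrN.
  have := normr_ge0 (a i); have := normr_ge0 (b i).
  move=> h1 h2 h3 h4 h5.
  have aP : (0 <= a i + P)%R by lra.
  have bP : (b i + 2 <= P)%R by lra.
  have P2 : (2 <= P)%R by lra.
  have qP : (2 / (b i - a i) <= P)%R by lra.
  split; [exact: mulr_ge0 (ltW P0) | exact: mulr_ge0 (ltW D0) (ltW P0) | |].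
    by have := ler_wpM2r (ltW P0) bP; lra.
  by rewrite ler_pdivrMr // mulrC in qP.
have tn i : ((s i)%:R <= (a i + P) * P < (s i).+1%:R)%R.
  by apply: truncn_itv; case: (main i).
have Dn i : ((beta (pi i))%:R - 2 <= (b i - a i) * P < (beta (pi i))%:R - 1)%R.
  have := @truncn_itv _ ((b i - a i) * P)%R; rewrite betapi natrD addrK.
  have [_ h _ _] := main i; move=> /(_ h) /andP[-> /=].
  by rewrite -natr1; lra.
exists pi, beta, s; split.
- by apply/forallP => i; rewrite /pi /= ltnS pic.
- split => //.
    move=> [|i] [|j] //= ij; first by rewrite addn2.
    rewrite leq_add2r; apply: le_truncn; rewrite ler_pM2r //.
    apply: (@sorted_leq_nth _ _ le_trans le_refl) => //.
    + by rewrite -[_ \in _]/(minn i c < size t)%N tsize ltnS geq_minr.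
    + by rewrite -[_ \in _]/(minn j c < size t)%N tsize ltnS geq_minr.
    + by rewrite leq_min geq_minr andbT (leq_trans (geq_minl _ _)).
  move=> i; rewrite -(ler_nat R) natrD /gsize !natrM !natrX -/P.
  have [_ _ h _] := main i; have /andP[h1 _] := tn i; have /andP[h2 _] := Dn i.
  lra.
- move=> z Qz; apply/in_gbox => i; have := Qz i; rewrite in_itv /= => zab.
  have az : (a i <= coordRn z i)%R.
    by move: zab => /andP[+ _]; case: (l i) => //= /ltW.
  have zb : (coordRn z i <= b i)%R.
    by move: zab => /andP[_]; case: (r i) => //= /ltW.
  have := ler_wpM2r (ltW P0) az; have := ler_wpM2r (ltW P0) zb.
  rewrite /pos -/P natrD; have /andP[h1 h1'] := tn i; have /andP[h2 h2'] := Dn i.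
  rewrite -natr1 in h1'; move=> h3 h4.
  apply/andP; split; first by lra.
  by rewrite -[ltRHS]/((s i)%:R + (beta (pi i))%:R)%R; lra.
have -> : (P ^+ d = \prod_(i < d) P)%R by rewrite prodr_const card_ord.
have -> : (2 ^+ d = \prod_(i < d) 2 :> R)%R by rewrite prodr_const card_ord.
rewrite natr_prod -prodf_div -big_split /=.
apply: ler_prod => i _; apply/andP; split; first by rewrite divr_ge0 // ltW.
rewrite ler_pdivrMr //; have [_ _ _ h] := main i; have /andP[h2 _] := Dn i.
have hh : ((beta (pi i))%:R <= 2 * (b i - a i) * P)%R by lra.
exact: hh.
Qed.

(** The rectangle is replaced by the box of [grid_box], of volume at most 2^d times larger. The
    threshold [N0] depends on [Q], hence the passage to the limit in N later. *)
Lemma avg_le_grid_maximal c (f : Rn R d -> R) (Q : set (Rn R d)) x :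
  measurable_fun setT f -> rectangles c.+1 Q -> Q x ->
  exists N0, forall N, (N0 <= N)%N -> forall F : X N -> R,
    (forall k, 0 <= F k)%R ->
    (forall k, (F k / (2 ^+ N) ^+ d)%:E = \int[mu]_(y in cell k) `|f y|%:E) ->
    exists2 k, cell k x &
      (mu Q)^-1 * \int[mu]_(y in Q) `|f y|%:E <= (2 ^+ d * grid_maximal c.+1 F k)%:E.
Proof.
move=> mf [a [b [l [r [ab [alpha [_ side]] ->]]]]] Qx.
pose S := (\sum_i (`|a i| + `|b i| + 2 + 2 / (b i - a i)))%R.
have pos0 i : (0 <= `|a i| + `|b i| + 2 + 2 / (b i - a i))%R.
  by rewrite !addr_ge0 // divr_ge0 // subr_ge0 ltW.
have S0 : (0 <= S)%R by exact: sumr_ge0.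
exists (Num.truncn S).+1 => N NS F F0 Ff.
have HN i : (`|a i| + `|b i| + 2 + 2 / (b i - a i) <= 2 ^+ N)%R.
  apply: (@le_trans _ _ S).
    by rewrite /S (bigD1 i) //= lerDl sumr_ge0.
  apply: ltW; apply: (lt_le_trans (truncnS_gt S)).
  rewrite -natrX ler_nat; apply: leq_trans NS _; apply: ltnW; exact: ltn_expl.
have [pi [beta [s [tpi [b0 bm sM] Qg vol]]]] := grid_box l r side ab HN.
have bpos j : (0 < beta j)%N by have := bm 0%N j isT; rewrite b0.
set G := gbox N s _ in Qg.
have [k ks kx] := (gbox_cell x sM).1 (Qg _ Qx).
exists k => //.
set B := box s _ in ks.
have mabs : measurable_fun setT (fun y => `|f y|%:E).
  by apply/measurable_EFinP; exact: measurableT_comp.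
have QG : \int[mu]_(y in rectangle a b l r) `|f y|%:E <= \int[mu]_(y in G) `|f y|%:E.
  apply: ge0_subset_integral.
  - exact: measurable_rectangle.
  - exact: measurable_gbox.
  - exact: measurable_funTS.
  - by move=> y _; rewrite lee_fin.
  - exact: Qg.
have D0 : (0 < \prod_i (b i - a i))%R by apply: prodr_gt0 => i _; rewrite subr_gt0.
rewrite lebesgue_rectangle // inver gt_eqF //.
rewrite -lee_pdivlMl ?invr_gt0 // -EFinM invrK.
apply: le_trans QG _; rewrite integral_gbox //.
apply: (@le_trans _ _ (\sum_(k in B) (F k / (2 ^+ N) ^+ d)%:E)).
  by apply: lee_sum => j _; rewrite Ff.
rewrite sumEFin lee_fin -mulr_suml avgE -/B card_box //.
have m0 : (0 <= avg B F)%R by exact: avg_ge0.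
have Bm : (avg B F <= grid_maximal c.+1 F k)%R.
  apply: le_grid_maximal => //; exists pi => //.
  by exists beta, s.
rewrite mulrAC; apply: (@le_trans _ _ (2 ^+ d * \prod_i (b i - a i) * avg B F)%R).
  by rewrite ler_wpM2r.
by rewrite [(2 ^+ d * _)%R]mulrC -mulrA ler_pM2l // ler_pM2l // exprn_gt0.
Qed.

End approximation.

(** * Lower limits and powers of extended reals *)

Section limits.
Context {R : realType}.

Lemma limn_einf_ge (u : (\bar R)^nat) (a : \bar R) N0 :
  (forall N, (N0 <= N)%N -> a <= u N) -> a <= limn_einf u.
Proof.
move=> au; rewrite limn_einf_lim; apply: lime_ge; first exact: is_cvg_einfs.
near=> n; apply: le_ereal_inf_tmp => _ [m /= nm <-]; apply: au.
by apply: leq_trans nm; near: n; exact: nbhs_infty_ge.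
Unshelve. all: by end_near. Qed.

Lemma limn_einf_le (u : (\bar R)^nat) (a : \bar R) :
  (forall N, u N <= a) -> limn_einf u <= a.
Proof.
move=> ua; rewrite limn_einf_lim; apply: lime_le; first exact: is_cvg_einfs.
by near=> n; apply: le_trans (ua n); apply: ereal_inf_lbound; exists n => /=.
Unshelve. all: by end_near. Qed.

(* The factor 2 spares a continuity argument at a finite [m]. *)
Lemma poweR_mul_le (p w : R) (m l : \bar R) : (0 < p)%R -> 0 <= m -> (0 <= w)%R ->
  0 <= l ->
  (forall t : R, (0 <= t)%R -> t%:E < m -> ((2 * t) `^ p * w)%R%:E <= l) ->
  m `^ p * w%:E <= l.
Proof.
move=> p0 m0 w0 l0 H; have pn0 : p != 0%R by rewrite gt_eqF.
case: m m0 H => [r| |] //.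
  rewrite lee_fin le_eqVlt => /orP[/eqP <- _|r0 H].
    by rewrite poweR0r // mul0e.
  have := H (r / 2)%R; rewrite poweR_EFin -EFinM.
  have -> : (2 * (r / 2) = r)%R by lra.
  apply; first by lra.
  by rewrite lte_fin; lra.
move=> _ H; rewrite poweRyr //.
move: w0; rewrite le_eqVlt => /orP[/eqP <-|w0]; first by rewrite mule0.
case: l l0 H => [r| |] //; last by move=> _ _; rewrite leey.
rewrite lee_fin => r0 H; exfalso.
(* For a finite bound r, the choice t = y^(1/p) / 2 gives (2 t)^p w = r + 1, a contradiction. *)
pose y := ((r + 1) / w)%R; have y0 : (0 < y)%R by apply: divr_gt0; lra.
have := H (y `^ p^-1 / 2)%R (divr_ge0 (powR_ge0 _ _) (ler0n _ _)) (ltry _).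
have -> : (2 * (y `^ p^-1 / 2) = y `^ p^-1)%R by lra.
rewrite -powRrM mulVf // powRr1 ?(ltW y0) // /y divfK ?gt_eqF // lee_fin; lra.
Qed.

End limits.

(** * Averages over cells *)

Section cells.
Context {R : realType} {d : nat}.
Local Notation mu := (lebesgue R d).
Local Notation X N := {ffun 'I_d -> 'I_(gsize N)}.

Lemma cell_integral_lty N (k : X N) (f : Rn R d -> R) : locally_integrable_Rn f ->
  \int[mu]_(x in cell k) `|f x|%:E < +oo.
Proof.
move=> [mf If].
pose a i : R := ((k i)%:R / 2 ^+ N - 2 ^+ N)%R.
pose b i : R := ((k i + 1)%:R / 2 ^+ N - 2 ^+ N)%R.
(* The closure of the cell, as a compact set of row vectors. *)
pose K : set 'rV[R]_d := [set v | forall i, `[a i, b i]%classic (v ord0 i)].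
have cK : compact K.
  by apply: (rV_compact (A := fun i => `[a i, b i]%classic)) => i; exact: segment_compact.
have KE : [set x : Rn R d | K (\row_i coordRn x i)%R] =
    rectangle a b xpredT xpredT.
  apply/seteqP; split => x /= H i; have := H i; rewrite /= ?mxE //.
have mabs : measurable_fun setT (fun y => `|f y|%:E).
  by apply/measurable_EFinP; exact: measurableT_comp.
apply: le_lt_trans (If _ cK); rewrite KE.
apply: ge0_subset_integral.
- exact: measurable_gbox.
- exact: measurable_rectangle.
- exact: measurable_funTS.
- by move=> x _; rewrite lee_fin.
move=> x H i; have := H i; rewrite /= !in_itv /= => /andP[-> /ltW].
by rewrite /b.
Qed.

Definition cell_avg N (f : Rn R d -> R) (k : X N) : R :=
  (fine (\int[mu]_(x in cell k) `|f x|%:E) * (2 ^+ N) ^+ d)%R.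

Lemma cell_avg_ge0 N f k : (0 <= @cell_avg N f k)%R.
Proof.
apply: mulr_ge0; last by rewrite !exprn_ge0.
by apply: fine_ge0; apply: integral_ge0.
Qed.

Lemma cell_avgE N f k : locally_integrable_Rn f ->
  (@cell_avg N f k / (2 ^+ N) ^+ d)%:E = \int[mu]_(x in cell k) `|f x|%:E.
Proof.
move=> lf; rewrite /cell_avg mulfK; last by rewrite gt_eqF // !exprn_gt0.
by rewrite fineK // ge0_fin_numE ?cell_integral_lty //; exact: integral_ge0.
Qed.

(** Jensen's inequality by way of the tangent line to y^p at the mean m: Young's inequality p m^(p -
    1) y <= y^p + (p - 1) m^p is integrated over the cell. *)
Lemma jensen_cell N f k (p : R) : (1 < p)%R -> locally_integrable_Rn f ->
  (@cell_avg N f k `^ p / (2 ^+ N) ^+ d)%:E <=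
  \int[mu]_(x in cell k) (`|f x| `^ p)%:E.
Proof.
move=> p1 lf; set m := cell_avg f k; set P := ((2 ^+ N) ^+ d)%R.
have P0 : (0 < P)%R by rewrite !exprn_gt0.
have p0 : (0 < p)%R by lra.
have q0 : (0 < p - 1)%R by lra.
have m0 : (0 <= m)%R by exact: cell_avg_ge0.
set I := \int[mu]_(x in _) _.
have I0 : 0 <= I by apply: integral_ge0 => x _; rewrite lee_fin powR_ge0.
have mp : (m * m `^ (p - 1) = m `^ p)%R by rewrite mulr_powRB1.
have young (y : R) : (0 <= y)%R ->
    (p * m `^ (p - 1) * y <= y `^ p + (p - 1) * m `^ p)%R.
  move=> y0; have := @conjugate_powR R y (m `^ (p - 1))%R p (p / (p - 1))%R
    y0 (powR_ge0 _ _) p0 (divr_gt0 p0 q0).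
  rewrite invf_div -powRrM.
  have -> : ((p - 1) * (p / (p - 1)) = p)%R by field; lra.
  have -> : (p^-1 + (p - 1) / p = 1)%R by field; lra.
  move=> /(_ erefl) H; have := ler_wpM2l (ltW p0) H.
  rewrite mulrDr; have -> : (p * (y `^ p / p) = y `^ p)%R by field; lra.
  have -> : (p * (m `^ p * ((p - 1) / p)) = (p - 1) * m `^ p)%R by field; lra.
  by rewrite [(y * _)%R]mulrC mulrA.
have mf := lf.1.
have mabs : measurable_fun setT (fun y => `|f y|%R).
  exact: measurableT_comp.
have mpow : measurable_fun setT (fun y => (`|f y| `^ p)%:E).
  apply/measurable_EFinP.
  by apply: (@measurableT_comp _ _ _ _ _ _ (fun y => y `^ p)%R) => //.
have mc : (measurable : set (set (Rn R d))) (cell k).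
  exact: measurable_gbox.
have : \int[mu]_(x in cell k) ((p * m `^ (p - 1))%:E * `|f x|%:E) <=
   \int[mu]_(x in cell k) ((`|f x| `^ p)%:E + ((p - 1) * m `^ p)%:E).
  apply: le_integral_nonmeasurable => x _.
  rewrite -EFinM -EFinD !lee_fin young // andbT.
  by rewrite !mulr_ge0 ?powR_ge0 // ltW.
have c0 : (0 <= (p - 1) * m `^ p)%R by rewrite mulr_ge0 ?powR_ge0 // ltW.
rewrite ge0_integralZl_EFin; last first.
- by rewrite mulr_ge0 ?powR_ge0 // ltW.
- by apply/measurable_EFinP; exact: measurable_funTS.
- by move=> x _; rewrite lee_fin.
- exact: mc.
have IE := cell_avgE k lf; rewrite -/m -/P in IE.
rewrite -IE ge0_integralD; last first.
- exact: measurable_cst.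
- by move=> x _; rewrite lee_fin.
- exact: measurable_funTS.
- by move=> x _; rewrite lee_fin powR_ge0.
- exact: mc.
rewrite integral_cst // lebesgue_gbox // big1 // mul1r -/P -/I.
rewrite -!EFinM; case: I I0 => [r| |] //; last by move=> *; rewrite leey.
move=> _; rewrite -EFinD !lee_fin.
have -> : (p * m `^ (p - 1) * (m / P) = p * (m `^ p / P))%R.
  by rewrite -mp; ring.
rewrite -mulrA; lra.
Qed.

End cells.

(** * Strong type inequality on R^d *)

Section strong_type.
Context {R : realType} {d : nat}.
Local Notation mu := (lebesgue R d).
Local Notation X N := {ffun 'I_d -> 'I_(gsize N)}.

(** The bound, uniform in N, that Fatou's lemma needs: the grid inequality for the cell averages of
    [f] and [w], followed by Jensen for [f] and by [iter_grid_maximal_le_iter_maximal] for the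
    weight. *)
Lemma grid_upper_bound N c (p K : R) (w f : Rn R d -> R) : (1 < p)%R -> (0 < K)%R ->
  (forall (f v : X N -> R), (forall x, 0 <= f x)%R -> (forall x, 0 <= v x)%R ->
    \sum_x grid_maximal c.+1 f x `^ p * v x <=
    K * \sum_x f x `^ p * iter_grid_maximal c.+1 v x)%R ->
  weight w -> locally_integrable_Rn f ->
  \sum_k ((2 * (2 ^+ d * grid_maximal c.+1 (@cell_avg R d N f) k)) `^ p)%:E *
     \int[mu]_(x in cell k) (w x)%:E <=
  ((2 * 2 ^+ d) `^ p * K)%:E *
    \int[mu]_x (`|(EFin \o f) x| `^ p * iter_maximal c.+1 (EFin \o w) x).
Proof.
move=> p1 K0 HK [w0 lw] lf.
set F := @cell_avg R d N f; pose v := @cell_avg R d N w.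
pose P : R := ((2 ^+ N) ^+ d)%R.
have P0 : (0 < P)%R by rewrite !exprn_gt0.
have F0 k : (0 <= F k)%R by exact: cell_avg_ge0.
have v0 k : (0 <= v k)%R by exact: cell_avg_ge0.
have p2 : (0 <= 2 * 2 ^+ d :> R)%R by rewrite mulr_ge0 // exprn_ge0.
have vw k : (v k / P)%:E = \int[mu]_(x in cell k) (w x)%:E.
  rewrite /v /P cell_avgE //; apply: eq_integral => x _.
  by rewrite ger0_norm.
pose u := iter_grid_maximal c.+1 v.
have u0 k : (0 <= u k)%R by exact: iter_grid_maximal_ge0.
have mpow : measurable_fun setT (fun y => (`|f y| `^ p)%:E).
  have mf := lf.1; have mabs : measurable_fun setT (fun y => `|f y|%R).
    exact: measurableT_comp.
  apply/measurable_EFinP.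
  by apply: (@measurableT_comp _ _ _ _ _ _ (fun y => y `^ p)%R) => //.
have pow0 x : 0 <= (`|f x| `^ p)%:E by rewrite lee_fin powR_ge0.
apply: (@le_trans _ _ (((2 * 2 ^+ d) `^ p * K)%:E *
   \int[mu]_x ((step u x)%:E * (`|f x| `^ p)%:E))); last first.
  apply: lee_wpmul2l; first by rewrite lee_fin mulr_ge0 ?powR_ge0 // ltW.
  apply: le_integral_nonmeasurable => x _.
  rewrite mule_ge0 ?lee_fin ?step_ge0 ?powR_ge0 //=.
  rewrite muleC lee_wpmul2l //.
  have [[k kx]|nk] := pselect (exists k : X N, cell k x).
    rewrite (step_cell _ kx).
    exact: (@iter_grid_maximal_le_iter_maximal R d N v w c w0 lw.1 v0 vw k x kx).
  rewrite step_out; last by move=> k kx; apply: nk; exists k.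
  exact: maximal_ge0.
rewrite integral_step //.
apply: (@le_trans _ _ (((2 * 2 ^+ d) `^ p * K)%:E *
   \sum_k (u k * (F k `^ p / P))%:E)); last first.
  apply: lee_wpmul2l; first by rewrite lee_fin mulr_ge0 ?powR_ge0 // ltW.
  apply: lee_sum => k _; rewrite EFinM; apply: lee_wpmul2l; first by rewrite lee_fin.
  exact: jensen_cell.
under eq_bigr do rewrite -vw -EFinM.
rewrite !sumEFin -EFinM lee_fin.
have -> : (\sum_k (2 * (2 ^+ d * grid_maximal c.+1 F k)) `^ p * (v k / P) =
    (2 * 2 ^+ d) `^ p * ((\sum_k grid_maximal c.+1 F k `^ p * v k) / P))%R.
  rewrite mulr_suml mulr_sumr; apply: eq_bigr => k _.
  have -> : (2 * (2 ^+ d * grid_maximal c.+1 F k) = 2 * 2 ^+ d * grid_maximal c.+1 F k)%R by ring.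
  by rewrite (powRM _ p2 (grid_maximal_ge0 _ _ _)); ring.
rewrite -mulrA ler_wpM2l ?powR_ge0 //.
have -> : (\sum_k u k * (F k `^ p / P) = (\sum_k F k `^ p * u k) / P)%R.
  by rewrite mulr_suml; apply: eq_bigr => k _; rewrite mulrCA mulrA.
by rewrite mulrA ler_pM2r ?invr_gt0 //; exact: HK.
Qed.

Lemma strong_type c (p : R) : (1 < p)%R -> exists2 K : R, (0 < K)%R &
  forall w f : Rn R d -> R, weight w -> locally_integrable_Rn f ->
  \int[mu]_x (`|maximal c.+1 (EFin \o f) x| `^ p * (EFin \o w) x) <=
  K%:E * \int[mu]_x (`|(EFin \o f) x| `^ p * iter_maximal c.+1 (EFin \o w) x).
Proof.
move=> p1; have [K K0 HK] := @discrete_strong R d c.+1 p p1.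
exists ((2 * 2 ^+ d) `^ p * K)%R.
  by rewrite mulr_gt0 // powR_gt0 // mulr_gt0 // exprn_gt0.
move=> w f ww lf; have [w0 lw] := ww.
set B := _ * \int[mu]_x _.
(* The factor 2^d comes from [avg_le_grid_maximal] and the outer 2 from [poweR_mul_le]. *)
pose c_ N (k : X N) := ((2 * (2 ^+ d * grid_maximal c.+1 (@cell_avg R d N f) k)) `^ p)%R.
pose G N x := (step (@c_ N) x)%:E * (w x)%:E.
have G0 N x : 0 <= G N x.
  by rewrite mule_ge0 // lee_fin // step_ge0 // => k; exact: powR_ge0.
have mG N : measurable_fun setT (G N).
  apply: emeasurable_funM; apply/measurable_EFinP; last exact: lw.1.
  exact: measurable_step.
have IG N : \int[mu]_x G N x <= B.
  rewrite /G integral_step.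
  - exact: (grid_upper_bound p1 K0 (HK _) ww lf).
  - by move=> k; exact: powR_ge0.
  - by move=> x; rewrite lee_fin.
  - by apply/measurable_EFinP; exact: lw.1.
apply: (@le_trans _ _ (limn_einf (fun N => \int[mu]_x G N x))); last first.
  exact: limn_einf_le.
apply: le_trans (fatou mu measurableT mG (fun N x _ => G0 N x)).
apply: le_integral_nonmeasurable => x _.
rewrite mule_ge0 ?poweR_ge0 //=; last by rewrite lee_fin.
rewrite gee0_abs ?maximal_ge0 //.
(* Any t below the maximal function at [x] is exceeded by the average over some rectangle, which all
   fine enough grids bound. *)
apply: poweR_mul_le => //.
- by lra.
- exact: maximal_ge0.
- by apply: (@limn_einf_ge _ _ _ 0%N) => N _.
move=> t t0 /ereal_sup_gt[_ [Q RQ <-]].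
have [Qx|Qx] := pselect (Q x); last first.
  by rewrite indicE memNset // mul0e lte_fin ltNge t0.
rewrite indicE mem_set // mul1e => tQ.
have [N0 HN] := avg_le_grid_maximal lf.1 RQ Qx.
apply: (@limn_einf_ge _ _ _ N0) => N NN.
have [k kx avgk] := HN N NN _ (@cell_avg_ge0 R d N f) (fun k => cell_avgE k lf).
rewrite /G (step_cell _ kx) /c_ -EFinM lee_fin ler_wpM2r //.
have tm : (t <= 2 ^+ d * grid_maximal c.+1 (@cell_avg R d N f) k)%R.
  by rewrite -lee_fin; apply: le_trans avgk; apply: ltW.
move: (2 ^+ d * _)%R tm => y ty.
have y0 : (0 <= y)%R by exact: le_trans ty.
have tyM : (2 * t <= 2 * y)%R by rewrite ler_pM2l.
have t20 : (2 * t \in Num.nneg)%R by rewrite nnegrE mulr_ge0.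
have y20 : (2 * y \in Num.nneg)%R by rewrite nnegrE mulr_ge0.
exact: (ge0_ler_powR (le_trans ler01 (ltW p1)) t20 y20 tyM).
Qed.

End strong_type.

Theorem corollary1p4 (R : realType) (d c : nat) (p : R)
    (hd : (1 <= d)%N) (hc : (1 <= c <= d)%N) (hp : (1 < p)%R) :
  exists2 C : R, (0 < C)%R &
    forall w f : Rn R d -> R,
      weight w -> locally_integrable_Rn f ->
      weighted_Lnorm (EFin \o w) p (maximal c (EFin \o f)) <=
      C%:E * weighted_Lnorm (iter_maximal c (EFin \o w)) p (EFin \o f).
Proof.
case: c hc => // c _.
have [K K0 HK] := @strong_type R d c p hp.
have pV0 : (0 <= p^-1)%R by rewrite invr_ge0; lra.
(* [strong_type] compares p-th powers of the norms, hence the p-th root of its constant. *)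
exists (K `^ p^-1)%R; first exact: powR_gt0.
move=> w f ww lf; rewrite /weighted_Lnorm -poweR_EFin.
set A := \int[_]_x _; set B := \int[_]_x _.
have w0 := ww.1.
have A0 : 0 <= A.
  by apply: integral_ge0 => x _; rewrite mule_ge0 ?poweR_ge0 // lee_fin.
have B0 : 0 <= B.
  apply: integral_ge0 => x _; rewrite mule_ge0 ?poweR_ge0 //.
  exact: maximal_ge0.
rewrite -poweRM ?lee_fin ?(ltW K0) //.
apply: gt0_ler_poweR => //.
- by rewrite in_itv /= A0 leey.
- by rewrite in_itv /= leey andbT mule_ge0 // lee_fin ltW.
exact: HK.
Qed.
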